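(* Let $\boldsymbol b_{DP}:[0,+\infty)\times\mathbb{R}^2\to\mathbb{R}^2$ be the Depauw vector field (defined in the context) and let $\bar\rho\in L^\infty(\mathbb{R}^2)$. Then there exist at least two (distinct) bounded weak solutions of the Cauchy problem $$\partial_t\rho+\operatorname{div}_x(\boldsymbol b_{DP}\,\rho)=0,\qquad \rho(0,x)=\bar\rho(x)$$ along $\boldsymbol b_{DP}$. Moreover, if $\bar\rho$ is non-negative and $\bar\rho\neq0$, then there exist at least two (distinct) non-negative bounded weak solutions of this Cauchy problem along $\boldsymbol b_{DP}$.
   Context: Bounded weak solution: for a bounded measurable vector field $\boldsymbol b:[0,+\infty)\times\mathbb{R}^2\to\mathbb{R}^2$ and $\bar\rho\in L^\infty(\mathbb{R}^2)$, a bounded weak solution along $\boldsymbol b$ with initial datum $\bar\rho$ is a function $\rho\in L^\infty_{loc}([0,+\infty);L^\infty(\mathbb{R}^2))$ such that for every $\phi\in C_c^\infty([0,+\infty)\times\mathbb{R}^2)$ $$\int_0^{+\infty}\int_{\mathbb{R}^2}\rho\,(\partial_t\phi+\boldsymbol b\cdot\nabla_x\phi)\,dx\,dt=-\int_{\mathbb{R}^2}\bar\rho(x)\phi(0,x)\,dx.$$ Solutions are distinct if they differ on a set of positive Lebesgue measure in $(0,+\infty)\times\mathbb{R}^2$; equalities and inequalities between functions are understood almost everywhere. Depauw vector field. Define $\boldsymbol w:\mathbb{R}^2\to\mathbb{R}^2$ by $$\boldsymbol w(x)=\begin{cases}(0,4x_1)&\text{if }1/2>|x_1|>|x_2|,\\(-4x_2,0)&\text{if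 }1/2>|x_2|>|x_1|,\\(0,0)&\text{otherwise.}\end{cases}$$ Let $\Lambda=\{(y_1,y_2)\in\mathbb{Z}^2: y_1+y_2\text{ is even}\}$ and $\boldsymbol u(x)=\sum_{y\in\Lambda}\boldsymbol w(x-y)$. Then $\boldsymbol b_{DP}$ is defined (for a.e. $t$) by $\boldsymbol b_{DP}(t,x)=0$ for $t>1$, and $\boldsymbol b_{DP}(t,x)=\boldsymbol u(2^kx)$ for $2^{-(k+1)}<t<2^{-k}$, $k=0,1,2,\dots$ (so in particular $\boldsymbol b_{DP}(t,x)=\boldsymbol u(x)$ for $1/2<t<1$). It is bounded and divergence-free. *)

(* Defs.v *)
From HB Require Import structures.
From mathcomp Require Import all_boot all_order all_algebra.
From mathcomp Require Import all_classical all_reals all_analysis.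

Set Implicit Arguments.
Unset Strict Implicit.
Unset Printing Implicit Defensive.
Import Order.TTheory GRing.Theory Num.Theory.
Import numFieldNormedType.Exports.

Local Open Scope classical_set_scope.
Local Open Scope ring_scope.

(* The plane R^2 is [R * R]; a point (t, x) of time-space is a [R * (R * R)].
   Measures are taken on products of [measurableTypeR R], which is convertible
   to R and carries the Borel sigma-algebra. *)

Definition leb2 (R : realType) :
    set (measurableTypeR R * measurableTypeR R)%type -> \bar R :=
  (@lebesgue_measure R \x @lebesgue_measure R)%E.

HB.instance Definition _ (R : realType) := Measure.on (@leb2 R).

(* The library's sigma-finiteness of products of sigma-finite measures is not
   found by canonical structure inference. *)
Lemma leb2_sigma_finite (R : realType) : sigma_finite setT (@leb2 R).
Proof.
have /sigma_finiteP[F [TF ndF Foo]] := sigma_finiteT (@lebesgue_measure R).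
exists (fun n => F n `*` F n).
  rewrite -setXTT TF predeqE => -[x y]; split.
    move=> [/= [n _ Fnx] [k _ Fky]]; exists (maxn n k) => //; split.
    - by move: x Fnx; exact/subsetPset/ndF/leq_maxl.
    - by move: y Fky; exact/subsetPset/ndF/leq_maxr.
  by move=> [n _ []/= ? ?]; split; exists n.
move=> k; have [mF oo] := Foo k.
split; first exact: measurableX.
by rewrite /leb2 product_measure1E// lte_mul_pinfty// ge0_fin_numE.
Qed.

HB.instance Definition _ (R : realType) :=
  Measure_isSigmaFinite.Build _ _ R (@leb2 R) (@leb2_sigma_finite R).

Definition leb3 (R : realType) :
    set (measurableTypeR R * (measurableTypeR R * measurableTypeR R))%type ->
    \bar R :=
  (@lebesgue_measure R \x @leb2 R)%E.

HB.instance Definition _ (R : realType) := Measure.on (@leb3 R).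

(* [C^n] for real functions on a finite-dimensional space: Frechet
   differentiable, all directional derivatives being C^(n-1). *)
Fixpoint continuously_differentiable (R : realType) (V : normedModType R)
    (n : nat) (phi : V -> R) : Prop :=
  if n is m.+1 then
    (forall z, differentiable phi z) /\
    (forall v, continuously_differentiable m ('D_v phi))
  else continuous phi.

Definition smooth (R : realType) (V : normedModType R) (phi : V -> R) : Prop :=
  forall n, continuously_differentiable n phi.

(* Elements of C_c^oo([0,+oo) x R^2) are the restrictions to t >= 0 of the
   elements of C_c^oo(R x R^2); only the values for t >= 0 are used below. *)
Definition test_function (R : realType) (phi : R * (R * R) -> R) : Prop :=
  smooth phi /\ compact (closure [set z | phi z != 0]).

Definition dt (R : realType) (phi : R * (R * R) -> R) : R * (R * R) -> R :=
  'D_(1, (0, 0)) phi.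
Definition grad_x (R : realType) (phi : R * (R * R) -> R)
    (z : R * (R * R)) : R * R :=
  ('D_(0, (1, 0)) phi z, 'D_(0, (0, 1)) phi z).
Definition dot2 (R : realType) (a b : R * R) : R := a.1 * b.1 + a.2 * b.2.

(* rho is in L^oo_loc([0,+oo); L^oo(R^2)); its values for t < 0 are
   irrelevant. *)
Definition Linfty_loc (R : realType) (rho : R * (R * R) -> R) : Prop :=
  forall T : R, 0 < T ->
    rho \_ (`[0, T] `*` setT) \in Lfun (@leb3 R) +oo%E.

Definition bounded_weak_solution (R : realType) (b : R * (R * R) -> R * R)
    (rhobar : R * R -> R) (rho : R * (R * R) -> R) : Prop :=
  Linfty_loc rho /\
  forall phi : R * (R * R) -> R, test_function phi ->
    (\int[@lebesgue_measure R]_(t in `[0%R, +oo[) \int[@leb2 R]_x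
        (rho (t, x) * (dt phi (t, x) + dot2 (b (t, x)) (grad_x phi (t, x))))%:E
     = - \int[@leb2 R]_x (rhobar x * phi (0, x))%:E)%E.

Definition distinct_solutions (R : realType) (rho1 rho2 : R * (R * R) -> R) :
    Prop :=
  (0 < @leb3 R [set z : R * (R * R) | (0 < z.1)%R /\ rho1 z <> rho2 z])%E.

Definition nonnegative_solution (R : realType) (rho : R * (R * R) -> R) : Prop :=
  {ae @leb3 R, forall z, 0 < z.1 -> 0 <= rho z}.

Definition depauw_w (R : realType) (x : R * R) : R * R :=
  if `|x.2| < `|x.1| < 1 / 2 then (0, 4 * x.1)
  else if `|x.1| < `|x.2| < 1 / 2 then (- 4 * x.2, 0)
  else (0, 0).

Definition even_lattice : set (int * int) := [set y | (2 %| y.1 + y.2)%Z].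

(* For each x at most one term of the sum is nonzero. *)
Definition depauw_u (R : realType) (x : R * R) : R * R :=
  \sum_(y \in even_lattice) depauw_w (x - (y.1%:~R, y.2%:~R)).

(* The index set of the sum has at most one element, and is empty if t > 1; at
   the remaining exceptional times (t <= 0 or t = 2^-k) the field is 0. *)
Definition depauw_b (R : realType) (z : R * (R * R)) : R * R :=
  \sum_(k \in [set k : nat | 2 ^- k.+1 < z.1 < 2 ^- k])
    depauw_u (2 ^+ k *: z.2).

(* Main.v *)
(* Let X(t, z) be the position at time t of the particle which is at z at time 1.
   The maps X(t, .) preserve Lebesgue measure for t > 0 and X is Lipschitz in t up
   to t = 0, so that rho(t, X(t, z)) = f(z) defines a weak solution whose datum is
   the image of the measure f dz under Y = X(0, .): testing with phi, the integral
   of f(z) phi(t, X(t, z)) dz is a Lipschitz function of t, which is integrated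
   against its right derivative.

   Between the times 2^-k and 2^-(k+1) the field turns every other cell of side
   2^-k by a quarter, which takes a chessboard of step 2^-k to the complement of
   the chessboard of step 2^-(k+1). The two colours of the unit chessboard of time
   1 are thus so finely mixed at time 2^-k that Y maps the Lebesgue measure
   restricted to either of them to one half of Lebesgue measure. Therefore f equal
   to g o Y on one colour and to h o Y on the other one yields a solution with
   datum (g + h) / 2. Distinct solutions come from the pairs (rhobar, rhobar) and
   (rhobar + 1, rhobar - 1), nonnegative ones from (rhobar, rhobar) and
   (2 rhobar, 0). *)

Require Import Defs.
From mathcomp Require Import all_boot all_order all_algebra.
From mathcomp Require Import all_classical all_reals all_analysis.
From mathcomp Require Import measurable_realfun ess_sup_inf zify ring lra.

Set Implicit Arguments.
Unset Strict Implicit.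
Unset Printing Implicit Defensive.
Import Order.TTheory GRing.Theory Num.Theory.
Import numFieldNormedType.Exports.

Local Open Scope classical_set_scope.
Local Open Scope ring_scope.

(** * Rotation of one cell *)

Section Rotation.
Context {R : realType}.
Implicit Types (s h a y : R) (p q : R * R).

(** The field jumps across the diagonals of its cells, so the flow is not taken from an existence
    theorem for differential equations but written down: in a cell a particle runs along a square at
    constant speed. Each branch of that formula is a product of shears, which preserve Lebesgue
    measure by Fubini, without Jacobians; the countably many branches are glued by [mp_piecewise].

    At time 0 the flow is only a uniform limit of such maps. What holds for the finite stages passes
    to it through closed boxes: an inequality between measures of boxes survives up to a thickening
    by a multiple of 2^-n, and a closed box is the intersection of its thickenings.

    In the weak formulation one time t is treated after another. At a positive time other than the
    2^-k, almost every trajectory is affine near t, so the difference quotients in t converge by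
    dominated convergence in z. The remaining times are countable. The double integral is met in its
    iterated form, and no exchange of integrals is made. *)

Definition quarter p : R * R := (- p.2, p.1).

(* The point reached by moving a distance y upwards along the right side of the
   square |x| <= a from its middle, around at most one corner. *)
Definition turn a y : R * R :=
  if a < y then quarter (a, y - 2 * a)
  else if y < - a then - quarter (a, y + 2 * a)
  else (a, y).

(* The flow of the field w for |s| <= 1/2, on the sector |p.2| <= p.1, where the
   speed is 4 * p.1, and then on the plane by symmetry. *)
Definition rot_right s p : R * R := turn p.1 (p.2 + 4 * s * p.1).

Definition right_sector p := - p.1 <= p.2 <= p.1.

(** The plane is the union of the right sector and its three images under quarter turns. They
    overlap on the diagonals, where the order of the tests selects one of two formulas. *)
Definition rot s p : R * R :=
  if right_sector p then rot_right s p
  else if right_sector (- p) then - rot_right s (- p)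
  else if right_sector (- quarter p) then quarter (rot_right s (- quarter p))
  else - quarter (rot_right s (quarter p)).

Lemma pair_eq p q : p.1 = q.1 -> p.2 = q.2 -> p = q.
Proof. by case: p q => [? ?] [? ?] /= -> ->. Qed.

Lemma quarterN p : quarter (- p) = - quarter p.
Proof. by case: p. Qed.

Lemma quarterK p : quarter (quarter p) = - p.
Proof. by case: p. Qed.

Lemma quarterD p q : quarter (p + q) = quarter p + quarter q.
Proof. by apply: pair_eq => //=; rewrite opprD. Qed.

Lemma sectorP p : exists2 q, right_sector q &
  [\/ p = q, p = - q, p = quarter q | p = - quarter q].
Proof.
have [h1|h1] := boolP (right_sector p); first by exists p => //; constructor 1.
have [h2|h2] := boolP (right_sector (- p)).
  by exists (- p) => //; constructor 2; rewrite opprK.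
have [h3|h3] := boolP (right_sector (- quarter p)).
  by exists (- quarter p) => //; constructor 3; rewrite quarterN quarterK opprK.
exists (quarter p); last by constructor 4; rewrite quarterK opprK.
case: p h1 h2 h3 => a b; rewrite /right_sector /quarter /= !opprK.
by case: (lerP (- b) a); case: (lerP a (- b)); case: (lerP b a);
  case: (lerP a b) => ? ? ? ?; rewrite ?andbF ?andbT //=; lra.
Qed.

Lemma right_sector_ge0 q : right_sector q -> 0 <= q.1.
Proof. by rewrite /right_sector => /andP[]; lra. Qed.

(** The side of the square has length [2 * a], so at most one corner is passed, as [turn]
    assumes. *)
Lemma displacement_bound s a : `|s| <= 1/2 -> 0 <= a ->
  - (2 * a) <= 4 * s * a /\ 4 * s * a <= 2 * a.
Proof. by rewrite ler_norml => /andP[? ?] ?; split; nra. Qed.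

Lemma turn_quarter a y : - a <= y <= 3 * a ->
  turn a y = quarter (turn a (y - 2 * a)).
Proof.
move=> /andP[y1 y2]; rewrite /turn.
case: (ltP a y) => h1.
  rewrite ifF; last by apply/negbTE; rewrite -leNgt; lra.
  by rewrite ifF //; apply/negbTE; rewrite -leNgt; lra.
rewrite ifF; last by apply/negbTE; rewrite -leNgt; lra.
rewrite ifF; last by apply/negbTE; rewrite -leNgt; lra.
case: ltP => h2; first by rewrite quarterN quarterK opprK subrK.
by apply: pair_eq => /=; lra.
Qed.

Lemma turn_quarterN a y : - (3 * a) <= y <= a ->
  turn a y = - quarter (turn a (y + 2 * a)).
Proof.
move=> /andP[y1 y2]; rewrite (@turn_quarter a (y + 2 * a)) ?addrK ?quarterK ?opprK//.
by apply/andP; split; lra.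
Qed.

(** The corner (a, a) belongs to the right sector and, as image of (a, - a), to the next one;
    agreement of the two formulas there makes the extension by symmetry consistent. *)
Lemma rot_right_diag s a : `|s| <= 1/2 -> 0 <= a ->
  rot_right s (a, a) = quarter (rot_right s (a, - a)).
Proof.
move=> hs a0; have [? ?] := displacement_bound hs a0.
rewrite /rot_right /= turn_quarter; last by apply/andP; split; lra.
by congr (quarter (turn _ _)); ring.
Qed.

Lemma rot_right0 s : rot_right s 0 = 0.
Proof.
by rewrite /rot_right /turn /= mulr0 addr0 oppr0 ltxx.
Qed.

Lemma rot_sector s q : `|s| <= 1/2 -> right_sector q ->
  [/\ rot s q = rot_right s q, rot s (- q) = - rot_right s q,
      rot s (quarter q) = quarter (rot_right s q) &
      rot s (- quarter q) = - quarter (rot_right s q)].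
Proof.
move=> hs hq; have a0 := right_sector_ge0 hq.
have q0 : right_sector (- q) -> q = 0.
  case: q hq {a0} => a b; rewrite /right_sector /= => /andP[? ?] /andP[? ?].
  by apply: pair_eq => /=; lra.
have qm : right_sector (quarter q) -> q = (q.1, - q.1).
  case: q hq {a0 q0} => a b; rewrite /right_sector /= => /andP[? ?] /andP[? ?].
  by apply: pair_eq => /=; lra.
have qp : right_sector (- quarter q) -> q = (q.1, q.1).
  case: q hq {a0 q0 qm} => a b; rewrite /right_sector /= => /andP[? ?] /andP[? ?].
  by apply: pair_eq => /=; lra.
have D := rot_right_diag hs a0.
have Eqp : - quarter (q.1, q.1) = (q.1, - q.1) by apply: pair_eq; rewrite /= ?opprK.
have Eqm : quarter (q.1, - q.1) = (q.1, q.1) by apply: pair_eq; rewrite /= ?opprK.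
split; rewrite /rot ?quarterN ?quarterK ?opprK ?hq //.
- by case: ifP => // /q0 ->; rewrite oppr0 rot_right0 oppr0.
- case: ifP => [/qm ->|_]; first by rewrite Eqm D.
  case: ifP => // /qp ->.
  by rewrite D quarterK Eqp.
- case: ifP => [/qp ->|_]; first by rewrite D quarterK opprK Eqp.
  case: ifP => [/qm ->|_]; first by rewrite Eqm D.
  by case: ifP => // /q0 ->; rewrite oppr0 rot_right0 /quarter /= !oppr0.
Qed.

Lemma rotN s p : `|s| <= 1/2 -> rot s (- p) = - rot s p.
Proof.
move=> hs; have [q hq [] ->] := sectorP p; have [e1 e2 e3 e4] := rot_sector hs hq;
  by rewrite ?opprK ?e1 ?e2 ?e3 ?e4 ?opprK.
Qed.

Lemma rot_quarter s p : `|s| <= 1/2 -> rot s (quarter p) = quarter (rot s p).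
Proof.
move=> hs; have [q hq [] ->] := sectorP p; have [e1 e2 e3 e4] := rot_sector hs hq;
  by rewrite ?quarterN ?quarterK ?opprK ?e1 ?e2 ?e3 ?e4 ?quarterN ?quarterK ?opprK.
Qed.

(** Two quarter turns are the opposite, so invariance under [quarter] alone carries a property from
    the right sector to all four. *)
Lemma sector_ind (P : R * R -> Prop) :
  (forall q, right_sector q -> P q) -> (forall q, P q -> P (quarter q)) ->
  forall p, P p.
Proof.
move=> P1 P2 p; have PN q : P q -> P (- q).
  by move=> ?; rewrite -quarterK; apply/P2/P2.
by have [q hq [] ->] := sectorP p; auto.
Qed.

(** Displacements along the square add up. If the first move leaves the right sector, a quarter turn
    brings the point back before the second one is computed. *)
Lemma rotD s h p : `|s| <= 1/2 -> `|h| <= 1/2 -> `|s + h| <= 1/2 ->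
  rot (s + h) p = rot h (rot s p).
Proof.
move=> s1 h1 sh1; elim/sector_ind: p => [[a b] hq|q IH]; last first.
  by rewrite !rot_quarter// IH.
have [-> _ _ _] := rot_sector s1 hq; have [-> _ _ _] := rot_sector sh1 hq.
have a0 := right_sector_ge0 hq; rewrite /= in a0.
have [] := displacement_bound s1 a0; have [] := displacement_bound h1 a0.
have [] := displacement_bound sh1 a0; rewrite mulrDr mulrDl.
have rotR y : right_sector (a, y) -> rot h (a, y) = turn a (y + 4 * h * a).
  by move=> hy; have [] := rot_sector h1 hy.
move: hq rotR; rewrite /right_sector /rot_right /= mulrDr mulrDl addrA.
move: (4 * s * a) (4 * h * a) => m n /andP[? ?] rotR ? ? ? ? ? ?.
rewrite {2}/turn; case: (ltP a (b + m)) => [?|?].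
  rewrite rot_quarter// rotR; last by apply/andP; split; lra.
  rewrite turn_quarter; last by apply/andP; split; lra.
  by rewrite -!addrA [_ + n]addrC.
case: (ltP (b + m) (- a)) => [?|?].
  rewrite rotN// rot_quarter// rotR; last by apply/andP; split; lra.
  rewrite turn_quarterN; last by apply/andP; split; lra.
  by rewrite -!addrA [_ + n]addrC.
by rewrite rotR //; apply/andP; split; lra.
Qed.

Lemma rot0 p : rot 0 p = p.
Proof.
have h0 : `|0 : R| <= 1/2 by rewrite normr0; lra.
elim/sector_ind: p => [q hq|q IH]; last by rewrite rot_quarter// IH.
have [-> _ _ _] := rot_sector h0 hq.
rewrite /rot_right /turn mulr0 mul0r addr0; move: hq => /andP[h1 h2].
by rewrite !ltNge h1 h2 /=; case: q {h1 h2}.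
Qed.

Lemma rotK s p : `|s| <= 1/2 -> rot (- s) (rot s p) = p.
Proof.
move=> hs; rewrite -rotD ?normrN ?subrr ?rot0// normr0; lra.
Qed.

End Rotation.

(** * Displacement and velocity of the rotation *)

Section RotationBounds.
Context {R : realType}.
Implicit Types (s h c : R) (p q : R * R).

(** The field [depauw_w] without its cut-off, which makes it positively homogeneous. *)
Definition wrot p : R * R :=
  if `|p.2| < `|p.1| then (0, 4 * p.1)
  else if `|p.1| < `|p.2| then (- 4 * p.2, 0) else 0.

Lemma norm_pair p : `|p| = Num.max `|p.1| `|p.2|.
Proof. by []. Qed.

Lemma norm_quarter p : `|quarter p| = `|p|.
Proof. by rewrite !norm_pair /= normrN maxC. Qed.

Lemma wrot_quarter p : wrot (quarter p) = quarter (wrot p).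
Proof.
rewrite /wrot /quarter /= normrN.
case: ltgtP => _; apply: pair_eq; rewrite /= ?oppr0 //; ring.
Qed.

Lemma norm_right_sector q : right_sector q -> `|q| = q.1.
Proof.
move=> hq; have a0 := right_sector_ge0 hq.
move: hq; rewrite /right_sector norm_pair -ler_norml => hq.
by rewrite (ger0_norm a0); apply/max_idPl.
Qed.

Lemma norm_rot s p : `|s| <= 1/2 -> `|rot s p| = `|p|.
Proof.
move=> hs; elim/(@sector_ind R): p => [q hq|q IH]; last first.
  by rewrite rot_quarter// !norm_quarter.
have [-> _ _ _] := rot_sector hs hq; rewrite (norm_right_sector hq).
have a0 := right_sector_ge0 hq; have [m1 m2] := displacement_bound hs a0.
have Nq y : - q.1 <= y <= q.1 -> `|(q.1, y)| = q.1.
  by move=> hy; rewrite norm_right_sector.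
move: hq; rewrite /right_sector /rot_right /turn => /andP[? ?].
case: ltP => [h1|h1]; first by rewrite norm_quarter Nq//; lra.
case: ltP => [h2|h2]; first by rewrite normrN norm_quarter Nq//; lra.
by rewrite Nq//; lra.
Qed.

Lemma norm_pair_le p c : (`|p| <= c) = (`|p.1| <= c) && (`|p.2| <= c).
Proof. by rewrite norm_pair ge_max. Qed.

Lemma norm_pair_lt p c : (`|p| < c) = (`|p.1| < c) && (`|p.2| < c).
Proof. by rewrite norm_pair gt_max. Qed.

Lemma rot_displacement h p : `|h| <= 1/2 ->
  `|rot h p - p| <= 4 * `|h| * `|p|.
Proof.
move=> hh; elim/(@sector_ind R): p => [q hq|q IH]; last first.
  rewrite rot_quarter// norm_quarter -quarterN -quarterD.
  by rewrite norm_quarter.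
have [-> _ _ _] := rot_sector hh hq; rewrite (norm_right_sector hq).
have a0 := right_sector_ge0 hq.
have E : 4 * `|h| * q.1 = `|4 * h * q.1|.
  by rewrite !normrM (ger0_norm a0) ger0_norm.
rewrite E norm_pair_le !ler_norml /rot_right /turn.
have := ler_norm (4 * h * q.1); have := ler_norm (- (4 * h * q.1)); rewrite normrN.
move: (4 * h * q.1) hq a0 {E} => m; rewrite /right_sector.
case: q => a b /= /andP[? ?] ? ? ?.
case: ltP => [h1|h1] /=; first by rewrite -!andbA; apply/and4P; split; lra.
case: ltP => [h2|h2] /=; by rewrite -!andbA; apply/and4P; split; lra.
Qed.

(** The second hypothesis bounds the displacement by the gap between the moduli of the coordinates:
    the point stays in its sector, where the motion is straight. *)
Lemma rot_wrot h p : `|h| <= 1/2 ->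
  4 * `|h| * `|p| <= `| `|p.1| - `|p.2| | -> rot h p = p + h *: wrot p.
Proof.
move=> hh; elim/(@sector_ind R): p => [q hq|q IH]; last first.
  rewrite rot_quarter// norm_quarter wrot_quarter /= normrN distrC => /IH ->.
  by apply: pair_eq => //=; rewrite opprD scalerN.
have [-> _ _ _] := rot_sector hh hq; rewrite (norm_right_sector hq).
have a0 := right_sector_ge0 hq.
have E : 4 * `|h| * q.1 = `|4 * h * q.1|.
  by rewrite !normrM (ger0_norm a0) ger0_norm.
have qn : `|q.2| <= q.1 by rewrite ler_norml.
rewrite E (ger0_norm a0) (_ : `|q.1 - _| = q.1 - `|q.2|); last first.
  by rewrite ger0_norm// subr_ge0.
move=> H; have H1 := ler_norm (4 * h * q.1); have H2 := ler_norm (- (4 * h * q.1)).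
have H3 := ler_norm q.2; have H4 := ler_norm (- q.2); rewrite !normrN in H2 H4.
have -> : rot_right h q = (q.1, q.2 + 4 * h * q.1).
  rewrite /rot_right /turn ltNge (_ : _ <= _ = true) /=; last by lra.
  by rewrite ltNge (_ : _ <= _ = true) //=; lra.
apply: pair_eq => /=.
  rewrite /wrot (ger0_norm a0); case: ltP => _ /=; first by rewrite scaler0 addr0.
  by rewrite ltNge qn /= scaler0 addr0.
rewrite /wrot (ger0_norm a0); case: ltP => h1 /=; first by rewrite /GRing.scale /=; ring.
rewrite ltNge qn /= scaler0 addr0; move: (normr_ge0 (4 * h * q.1)); lra.
Qed.

End RotationBounds.

(** * Measure preserving maps *)

Lemma preimage_measurable d1 d2 (T1 : measurableType d1) (T2 : measurableType d2)
  (f : T1 -> T2) (A : set T2) :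
  measurable_fun setT f -> measurable A -> measurable (f @^-1` A).
Proof. by move=> mf mA; rewrite -[X in measurable X]setTI; exact: mf. Qed.

Section MeasurePreserving.
Context {d} {T : measurableType d} {R : realType} (mu : {measure set T -> \bar R}).
Implicit Types (f g : T -> T).

Definition measure_preserving f :=
  measurable_fun setT f /\ (forall A, measurable A -> mu (f @^-1` A) = mu A).

Definition mp_injection f := measure_preserving f /\ injective f.

Lemma eq_mp_injection f g : f =1 g -> mp_injection f -> mp_injection g.
Proof. by move=> /funext ->. Qed.

Lemma mp_id : mp_injection id.
Proof. by split => //; split => //; exact: measurable_id. Qed.

Lemma mp_comp f g : measure_preserving f -> measure_preserving g ->
  measure_preserving (f \o g).
Proof.
move=> [mf f1] [mg g1]; split; first exact: measurableT_comp.
move=> A mA; rewrite comp_preimage g1 ?f1//.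
exact: preimage_measurable.
Qed.

Lemma mp_injection_comp f g : mp_injection f -> mp_injection g ->
  mp_injection (f \o g).
Proof.
by move=> [f1 f2] [g1 g2]; split; [exact: mp_comp|exact: inj_comp].
Qed.

Lemma measure_fibers (f : T -> nat) (A : set T) : measurable_fun setT f ->
  measurable A -> mu A = (\sum_(n <oo) mu (A `&` f @^-1` [set n]))%E.
Proof.
move=> mf mA; have mD n : measurable (A `&` f @^-1` [set n]).
  by apply: measurableI => //; exact: preimage_measurable.
have {1}-> : A = \bigcup_n (A `&` f @^-1` [set n]).
  by apply/seteqP; split=> [x Ax|x [n _ []]//]; exists (f x).
rewrite measure_semi_bigcup//; last exact: bigcupT_measurable.
exact/trivIset_setIl/trivIset_preimage1.
Qed.

(* The part of the preimage of A lying in the i-th piece is the preimage under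
   the i-th injection of the part of A lying in the image of that piece. *)
Lemma mp_piecewise (idx : T -> nat) (F : nat -> T -> T) f g :
  measurable_fun setT idx -> (forall i, mp_injection (F i)) ->
  (forall x, f x = F (idx x) x) ->
  measurable_fun setT f -> measurable_fun setT g ->
  cancel f g -> cancel g f -> measure_preserving f.
Proof.
move=> midx mpF fF mf mg fK gK; split=> // A mA.
have mfA : measurable (f @^-1` A) by exact: preimage_measurable.
rewrite (measure_fibers midx mfA) (measure_fibers (measurableT_comp midx mg) mA).
apply: eq_eseriesr => n _; have [[mFn Fn] injF] := mpF n.
rewrite -[RHS]Fn; last first.
  apply: measurableI => //.
  by apply: preimage_measurable => //; exact: (measurableT_comp midx mg).
congr (mu _); apply/seteqP; split => x /=.
  by move=> [fx xn]; rewrite -xn -fF fK.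
move=> [Ax gn]; have gx : g (F n x) = x by apply: injF; rewrite -{1}gn -fF gK.
by rewrite gx in gn; split; rewrite ?fF ?gn.
Qed.

End MeasurePreserving.

(** * Elementary measure preserving maps of the plane *)

Section PlaneMaps.
Context {R : realType}.
Local Notation mR := (measurableTypeR R).
Local Notation leb := (@lebesgue_measure R).
Local Notation mu := (@leb2 R).

Lemma measurable_addr (c : R) :
  measurable_fun (setT : set mR) (fun x : mR => (x + c : mR)).
Proof. exact: measurable_funD. Qed.

Lemma lebesgue_translation (c : R) (A : set mR) : measurable A ->
  leb ((fun x : mR => x + c) @^-1` A) = leb A.
Proof.
move=> mA; apply/esym.
apply: (@lebesgue_measure_unique R (pushforward leb (fun x : mR => (x + c : mR)))) => //.
  exact: measurable_addr.
move=> mf _ [[a b] /= ab <-]; rewrite /pushforward.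
have -> : (fun x : mR => x + c) @^-1` `]a, b]%classic = `]a - c, b - c]%classic.
  by apply/seteqP; split=> x /=; rewrite !in_itv /= ltrBlDr lerBrDr.
by rewrite !lebesgue_measure_itv /= !lte_fin ltrD2r -!EFinB opprD addrACA subrr addr0.
Qed.

Definition shear (c : R -> R) (p : mR * mR) : mR * mR := (p.1, p.2 + c p.1).

(** Each vertical section is merely translated, and [leb2] integrates the lengths of the vertical
    sections. *)
Lemma mp_shear (c : mR -> mR) : measurable_fun setT c -> mp_injection mu (shear c).
Proof.
move=> mc; split; last by move=> [a b] [a' b'] [-> /addIr ->].
have ms : measurable_fun setT (shear c).
  apply/measurable_fun_pairP; split; first exact: measurable_fst.
  apply: measurable_funD; first exact: measurable_snd.
  exact: (measurableT_comp mc).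
split=> // A mA; rewrite /leb2 /product_measure1.
apply: eq_integral => x _ /=.
rewrite -[RHS](@lebesgue_translation (c x)); last exact: measurable_xsection.
by congr (leb _); apply/seteqP; split=> y; rewrite /xsection /= !in_setE.
Qed.

Definition swap2 (p : mR * mR) : mR * mR := (p.2, p.1).

Lemma measurable_swap2 : measurable_fun setT swap2.
Proof.
by apply/measurable_fun_pairP; split; [exact: measurable_snd|exact: measurable_fst].
Qed.

Lemma mp_swap : mp_injection mu swap2.
Proof.
split; last by move=> [a b] [a' b'] [-> ->].
split; first exact: measurable_swap2.
move=> A mA; apply/esym.
apply: (@product_measure_unique _ _ _ _ _ leb leb (pushforward mu swap2)) => //.
  exact: measurable_swap2.
move=> ms B C mB mC /=; rewrite /pushforward.
have -> : swap2 @^-1` (B `*` C) = C `*` B.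
  by apply/seteqP; split=> -[x y] [].
by rewrite /leb2 product_measure1E// muleC.
Qed.
End PlaneMaps.

(** * Measurability of the rotation, jointly in time and position *)

Section Compositional.
Context {R : realType} {d} {T : measurableType d}.
Local Notation mR := (measurableTypeR R).
Implicit Types (p q : T -> mR * mR) (s t : T -> mR) (b : T -> bool).

Lemma measurable_coord1 p : measurable_fun setT p -> measurable_fun setT (fun x => (p x).1 : mR).
Proof. exact: measurableT_comp. Qed.

Lemma measurable_coord2 p : measurable_fun setT p -> measurable_fun setT (fun x => (p x).2 : mR).
Proof. exact: measurableT_comp. Qed.

Lemma measurable_pairing s t : measurable_fun setT s -> measurable_fun setT t ->
  measurable_fun setT (fun x => (s x, t x)).
Proof. by move=> ms mt; apply/measurable_fun_pairP; split. Qed.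

Lemma measurable_oppP p : measurable_fun setT p -> measurable_fun setT (fun x => - p x : mR * mR).
Proof.
move=> mp; apply: measurable_pairing; apply: measurable_funN.
- exact: measurable_coord1.
- exact: measurable_coord2.
Qed.

Lemma measurable_addP p q : measurable_fun setT p -> measurable_fun setT q ->
  measurable_fun setT (fun x => p x + q x : mR * mR).
Proof.
move=> mp mq; apply: measurable_pairing; apply: measurable_funD.
- exact: measurable_coord1.
- exact: measurable_coord1.
- exact: measurable_coord2.
- exact: measurable_coord2.
Qed.

Lemma measurable_quarter p : measurable_fun setT p ->
  measurable_fun setT (fun x => quarter (p x) : mR * mR).
Proof.
move=> mp; apply: measurable_pairing; last exact: measurable_coord1.
by apply: measurable_funN; exact: measurable_coord2.
Qed.

Lemma measurable_right_sector p : measurable_fun setT p ->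
  measurable_fun setT (fun x => right_sector (p x)).
Proof.
move=> mp; apply: measurable_and; apply: measurable_fun_ler => //.
- by apply: measurable_funN; exact: measurable_coord1.
- exact: measurable_coord2.
- exact: measurable_coord2.
- exact: measurable_coord1.
Qed.

Lemma measurable_displaced s p : measurable_fun setT s -> measurable_fun setT p ->
  measurable_fun setT (fun x => (p x).2 + 4 * s x * (p x).1 : mR).
Proof.
move=> ms mp; apply: measurable_funD; first exact: measurable_coord2.
apply: measurable_funM; last exact: measurable_coord1.
exact: measurable_funM.
Qed.

(** The target is arbitrary because the same case distinction serves the points [rot_right] and the
    integers [turn_code]. *)
Lemma measurable_turn_ifs d' (T' : measurableType d') s p (u v w : T -> T') :
  measurable_fun setT s -> measurable_fun setT p ->
  measurable_fun setT u -> measurable_fun setT v -> measurable_fun setT w ->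
  measurable_fun setT (fun x => let y := (p x).2 + 4 * s x * (p x).1 in
    if (p x).1 < y then u x else if y < - (p x).1 then v x else w x).
Proof.
move=> ms mp mu mv mw; have my := measurable_displaced ms mp.
apply: measurable_fun_ifT => //.
  by apply: measurable_fun_ltr => //; exact: measurable_coord1.
apply: measurable_fun_ifT => //; apply: measurable_fun_ltr => //.
by apply: measurable_funN; exact: measurable_coord1.
Qed.

Lemma measurable_rot_right s p : measurable_fun setT s -> measurable_fun setT p ->
  measurable_fun setT (fun x => rot_right (s x) (p x) : mR * mR).
Proof.
move=> ms mp; have m1 := measurable_coord1 mp; have my := measurable_displaced ms mp.
apply: measurable_turn_ifs => //.
- apply: measurable_quarter; apply: measurable_pairing => //.
  by apply: measurable_funB => //; exact: measurable_funM.
- apply/measurable_oppP/measurable_quarter; apply: measurable_pairing => //.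
  by apply: measurable_funD => //; exact: measurable_funM.
- exact: measurable_pairing.
Qed.

Lemma measurable_sector_ifs d' (T' : measurableType d') p (u v w z : T -> T') :
  measurable_fun setT p -> measurable_fun setT u -> measurable_fun setT v ->
  measurable_fun setT w -> measurable_fun setT z ->
  measurable_fun setT (fun x => if right_sector (p x) then u x
    else if right_sector (- p x) then v x
    else if right_sector (- quarter (p x)) then w x else z x).
Proof.
move=> mp mu mv mw mz; apply: measurable_fun_ifT => //.
  exact: measurable_right_sector.
apply: measurable_fun_ifT => //.
  exact/measurable_right_sector/measurable_oppP.
apply: measurable_fun_ifT => //.
exact/measurable_right_sector/measurable_oppP/measurable_quarter.
Qed.

Lemma measurable_rot s p : measurable_fun setT s -> measurable_fun setT p ->
  measurable_fun setT (fun x => rot (s x) (p x) : mR * mR).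
Proof.
move=> ms mp; apply: measurable_sector_ifs => //.
- exact: measurable_rot_right.
- by apply/measurable_oppP/measurable_rot_right => //; exact: measurable_oppP.
- apply/measurable_quarter/measurable_rot_right => //.
  exact/measurable_oppP/measurable_quarter.
- apply/measurable_oppP/measurable_quarter/measurable_rot_right => //.
  exact/measurable_quarter.
Qed.

End Compositional.

(** * The rotation preserves Lebesgue measure *)

Section RotationMeasurePreserving.
Context {R : realType}.
Local Notation mR := (measurableTypeR R).
Local Notation mu := (@leb2 R).
Implicit Types (s : R) (p v : mR * mR).

Lemma mp_hshear (c : mR -> mR) : measurable_fun setT c ->
  mp_injection mu (fun p => (p.1 + c p.2, p.2) : mR * mR).
Proof.
move=> mc; have ms := @mp_swap R.
by apply: eq_mp_injection (mp_injection_comp ms (mp_injection_comp (mp_shear mc) ms)).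
Qed.

Lemma mp_add v : mp_injection mu (fun p => p + v).
Proof.
have h1 := @mp_hshear (cst v.1) (measurable_cst _).
have h2 := @mp_shear R (cst v.2) (measurable_cst _).
by apply: eq_mp_injection (mp_injection_comp h1 h2).
Qed.

(** A rotation by a right angle is a product of three shears: horizontal, vertical, horizontal. *)
Lemma mp_quarter : mp_injection mu quarter.
Proof.
have h1 : mp_injection mu (fun p => (p.1 - p.2, p.2) : mR * mR).
  by apply: (@mp_hshear (fun x => - x)); exact: measurable_funN.
have h2 := @mp_shear R id (@measurable_id _ _ _).
apply: eq_mp_injection (mp_injection_comp h1 (mp_injection_comp h2 h1)) => -[a b].
by apply: pair_eq; rewrite /quarter /=; ring.
Qed.

Lemma mp_opp : mp_injection mu (fun p => - p).
Proof.
by apply: eq_mp_injection (mp_injection_comp mp_quarter mp_quarter) => p; exact: quarterK.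
Qed.

Lemma mp_shear_linear (c : R) : mp_injection mu (shear (fun x : mR => c * x)).
Proof. by apply: mp_shear; exact: measurable_funM. Qed.

(** The branches of [turn] as linear maps of the whole plane: the correction by [2 * a] is itself a
    shear, since [a] is the first coordinate. *)
Definition turn_piece (i : nat) : mR * mR -> mR * mR :=
  match i with
  | 0 => quarter \o shear (fun x => - 2 * x)
  | 1 => (fun p => - p) \o (quarter \o shear (fun x => 2 * x))
  | _ => id
  end.

Lemma mp_turn_piece i : mp_injection mu (turn_piece i).
Proof.
case: i => [|[|i]]; last exact: mp_id.
  exact: (mp_injection_comp mp_quarter (mp_shear_linear _)).
by apply/(mp_injection_comp mp_opp)/(mp_injection_comp mp_quarter)/mp_shear_linear.
Qed.

Definition rot_right_piece s i : mR * mR -> mR * mR :=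
  turn_piece i \o shear (fun x => 4 * s * x).

Lemma mp_rot_right_piece s i : mp_injection mu (rot_right_piece s i).
Proof. exact: (mp_injection_comp (mp_turn_piece i) (mp_shear_linear _)). Qed.

Definition turn_code s p : nat :=
  let y := p.2 + 4 * s * p.1 in
  if p.1 < y then 0 else if y < - p.1 then 1 else 2.

Lemma rot_right_pieceE s p : rot_right s p = rot_right_piece s (turn_code s p) p.
Proof.
rewrite /rot_right /turn /turn_code /rot_right_piece.
case: ifP => _; last case: ifP => _ //; apply: pair_eq; rewrite /= ?mulNr//.
Qed.

(** The first index tells the sector, the second one the corner that is passed, if any. *)
Definition rot_piece s (i : nat * nat) : mR * mR -> mR * mR :=
  let f := rot_right_piece s i.2 in
  match i.1 with
  | 0 => f
  | 1 => (fun p => - p) \o (f \o (fun p => - p))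
  | 2 => quarter \o (f \o ((fun p => - p) \o quarter))
  | _ => (fun p => - p) \o (quarter \o (f \o quarter))
  end.

Lemma mp_rot_piece s i : mp_injection mu (rot_piece s i).
Proof.
have mf := mp_rot_right_piece s i.2; have mo := mp_opp; have mq := mp_quarter.
by case: i mf => [[|[|[|i]]] j] /= mf; do ?[done|apply: mp_injection_comp].
Qed.

Definition rot_code s p : nat * nat :=
  if right_sector p then (0, turn_code s p)%N
  else if right_sector (- p) then (1, turn_code s (- p))%N
  else if right_sector (- quarter p) then (2, turn_code s (- quarter p))%N
  else (3, turn_code s (quarter p))%N.

Lemma rot_pieceE s p : rot s p = rot_piece s (rot_code s p) p.
Proof.
rewrite /rot /rot_code /rot_piece.
by do 3?[case: ifP => _ /=; first by rewrite rot_right_pieceE]; rewrite rot_right_pieceE.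
Qed.

Lemma measurable_turn_code s (g : mR * mR -> mR * mR) : measurable_fun setT g ->
  measurable_fun setT (fun p => turn_code s (g p)).
Proof. by move=> mg; apply: (measurable_turn_ifs (s := cst s)). Qed.

Lemma mp_rot s : `|s| <= 1/2 -> mp_injection mu (rot s).
Proof.
move=> hs.
have mr t : measurable_fun setT (rot t : mR * mR -> mR * mR).
  exact: (@measurable_rot _ _ _ (cst t) id).
split; last first.
  by apply: (can_inj (g := rot (- s))) => p; exact: rotK.
have hs' : `|- s| <= 1/2 by rewrite normrN.
have rK' p : rot s (rot (- s) p) = p by rewrite -{1}(opprK s) rotK.
(* [pickle] turns the pair of codes into a natural number; the identity fills the numbers that
   decode to nothing. *)
apply: (@mp_piecewise _ _ _ mu (pickle \o rot_code s)
    (fun n => if unpickle n is Some i then rot_piece s i else id)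
    (rot s) (rot (- s))) => //.
- have mg (g : mR * mR -> mR * mR) (i : nat) : measurable_fun setT g ->
      measurable_fun setT (fun p => pickle (i, turn_code s (g p))).
    move=> mg; have mi : measurable_fun setT (fun n : nat => pickle (i, n)) by [].
    exact: (measurableT_comp mi (measurable_turn_code s mg)).
  rewrite (_ : _ \o _ = fun p => if right_sector p then pickle (0%N, turn_code s p)
    else if right_sector (- p) then pickle (1%N, turn_code s (- p))
    else if right_sector (- quarter p) then pickle (2%N, turn_code s (- quarter p))
    else pickle (3%N, turn_code s (quarter p))); last first.
    by apply/funext => p; rewrite /rot_code /=; do 3?[case: ifP => _ //].
  apply: measurable_sector_ifs => //; apply: mg => //.
  + exact: measurable_oppP.
  + exact/measurable_oppP/measurable_quarter.
  + exact/measurable_quarter.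
- by move=> n; case: unpickle => [i|]; [exact: mp_rot_piece|exact: mp_id].
- by move=> p; rewrite /= pickleK rot_pieceE.
- by move=> p; exact: rotK.
Qed.

End RotationMeasurePreserving.

(** * Rotation of a lattice of cells *)

Section CountableValued.
Context {d} {T : measurableType d} {I : countType}.

(** For a map into a countable type this makes every function of its value measurable, and no
    sigma-algebra on the index type has to be chosen. *)
Definition measurable_fibers (g : T -> I) := forall i, measurable (g @^-1` [set i]).

Lemma measurable_comp_fibers d' (T' : measurableType d') (g : T -> I) (h : I -> T') :
  measurable_fibers g -> measurable_fun setT (h \o g).
Proof.
move=> mg _ B mB; rewrite setTI.
rewrite (_ : _ @^-1` B = \bigcup_i (g @^-1` [set i] `&` [set _ | B (h i)])).
  apply: countable_bigcupT_measurable; first exact: countableP.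
  move=> i; have [Bi|nBi] := pselect (B (h i)).
    rewrite (_ : [set _ | _] = setT) ?setIT; first exact: mg.
    by apply/seteqP; split.
  rewrite (_ : [set _ | _] = set0) ?setI0; first exact: measurable0.
  by apply/seteqP; split.
apply/seteqP; split=> [x /= Bx|x [i _ [/= <-]]//].
by exists (g x).
Qed.

End CountableValued.

Lemma measurable_fibers_pair d (T : measurableType d) (I J : countType)
    (f : T -> I) (g : T -> J) :
  measurable_fibers f -> measurable_fibers g -> measurable_fibers (fun x => (f x, g x)).
Proof.
move=> mf mg [i j].
rewrite (_ : _ @^-1` _ = f @^-1` [set i] `&` g @^-1` [set j]).
  exact: measurableI.
by apply/seteqP; split=> x /= [-> ->].
Qed.

Lemma measurable_fibers_floor d (T : measurableType d) (R : realType)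
    (r : T -> measurableTypeR R) : measurable_fun setT r ->
  measurable_fibers (fun x => Num.floor (r x : R)).
Proof.
move=> mr i; rewrite (_ : _ @^-1` _ = r @^-1` `[i%:~R, (i + 1)%:~R[%classic).
  by apply: preimage_measurable => //; exact: measurable_itv.
apply/seteqP; split=> x /=; rewrite in_itv /=; first by move=> <-; exact: floor_itv.
by move/floor_def.
Qed.

Section CellRotation.
Context {R : realType}.
Local Notation mR := (measurableTypeR R).
Local Notation mu := (@leb2 R).
Implicit Types (d s h : R) (x v : R * R) (y : int * int).

(** Rounding to the nearest point of the lattice of step [d]. *)
Definition cell_index d x : int * int :=
  (Num.floor (x.1 / d + 1 / 2), Num.floor (x.2 / d + 1 / 2)).

Definition lattice_point d y : R * R := (d * y.1%:~R, d * y.2%:~R).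

Definition cell_center d x := lattice_point d (cell_index d x).

(** The parity selects the lattice of the moving cells; the strict inequality leaves their borders
    at rest. *)
Definition in_cell d x : bool :=
  (2 %| (cell_index d x).1 + (cell_index d x).2)%Z && (`|x - cell_center d x| < d / 2).

(** Near the centre c of a moving cell the field [depauw_u (d^-1 *: x)] is [wrot (x - c)] divided by
    [d], by homogeneity. Time [s] is thus time [s / d] of the rotation, and [d / 2] is the time of a
    quarter turn. *)
Definition cell_rot d s x : R * R :=
  if in_cell d x then cell_center d x + rot (s / d) (x - cell_center d x) else x.

Lemma cell_indexE d x y : 0 < d -> `|x - lattice_point d y| < d / 2 -> cell_index d x = y.
Proof.
move=> d0; case: y => y1 y2; rewrite norm_pair_lt /= !ltr_norml.
move=> /andP[/andP[h1 h2] /andP[h3 h4]].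
have aux (u : R) (z : int) : - (d / 2) < u - d * z%:~R -> u - d * z%:~R < d / 2 ->
    Num.floor (u / d + 1 / 2) = z.
  have -> : u = d * (u / d) by rewrite mulrC divfK// gt_eqF.
  rewrite [d * (u / d) / d]mulrC mulKf ?gt_eqF//; move: (u / d) => w e1 e2.
  have : - (1 / 2) < w - z%:~R by rewrite -(ltr_pM2l d0); lra.
  have : w - z%:~R < 1 / 2 by rewrite -(ltr_pM2l d0); lra.
  by move=> ? ?; apply: floor_def; apply/andP; split; rewrite ?intrD; lra.
by rewrite /cell_index (aux _ y1)// (aux _ y2).
Qed.

Lemma cell_rot_cell d s x : 0 < d -> `|s| <= d / 2 -> in_cell d x ->
  in_cell d (cell_rot d s x) /\ cell_center d (cell_rot d s x) = cell_center d x.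
Proof.
move=> d0 hs hx; have /andP[par nx] := hx.
have sd : `|s / d| <= 1 / 2.
  by rewrite normrM normfV (gtr0_norm d0) ler_pdivrMr// mul1r mulrC.
have nx' : `|cell_rot d s x - cell_center d x| < d / 2.
  by rewrite /cell_rot hx addrC addKr norm_rot.
have ix := cell_indexE d0 nx'.
have cx : cell_center d (cell_rot d s x) = cell_center d x by rewrite /cell_center ix.
by split=> //; rewrite /in_cell cx ix par.
Qed.

Lemma cell_rot_out d s x : ~~ in_cell d x -> cell_rot d s x = x.
Proof. by move=> /negbTE nx; rewrite /cell_rot nx. Qed.

Lemma cell_rotD d s h x : 0 < d ->
  `|s| <= d / 2 -> `|h| <= d / 2 -> `|s + h| <= d / 2 ->
  cell_rot d (s + h) x = cell_rot d h (cell_rot d s x).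
Proof.
move=> d0 hs hh hsh; have [hx|hx] := boolP (in_cell d x); last by rewrite !cell_rot_out.
have [hx' cx'] := cell_rot_cell d0 hs hx.
have nd u : `|u| <= d / 2 -> `|u / d| <= 1 / 2.
  by move=> ?; rewrite normrM normfV (gtr0_norm d0) ler_pdivrMr// mul1r mulrC.
rewrite [RHS]/cell_rot hx' cx' /cell_rot hx; congr (_ + _).
rewrite [_ + rot _ _ - _]addrAC subrr add0r mulrDl rotD ?nd//.
by rewrite -mulrDl nd.
Qed.

Lemma cell_rot0 d x : cell_rot d 0 x = x.
Proof. by rewrite /cell_rot mul0r rot0 addrC subrK; case: ifP. Qed.

Lemma cell_rotK d s : 0 < d -> `|s| <= d / 2 ->
  cancel (cell_rot d s) (cell_rot d (- s)).
Proof.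
move=> d0 hs x; rewrite -cell_rotD ?normrN ?subrr ?cell_rot0//.
by rewrite normr0 divr_ge0// ltW.
Qed.

(** The speed at distance r from the centre is 4 r / d with r < d / 2, hence less than 2 at every
    scale; this gives the Lipschitz constant of the flow. *)
Lemma cell_rot_displacement d s x : 0 < d -> `|s| <= d / 2 ->
  `|cell_rot d s x - x| <= 2 * `|s|.
Proof.
move=> d0 hs; have [hx|hx] := boolP (in_cell d x); last first.
  by rewrite cell_rot_out// subrr normr0 mulr_ge0.
rewrite /cell_rot hx; have /andP[_ nx] := hx.
have sd : `|s / d| <= 1 / 2.
  by rewrite normrM normfV (gtr0_norm d0) ler_pdivrMr// mul1r mulrC.
rewrite (_ : _ + rot _ _ - x =
  rot (s / d) (x - cell_center d x) - (x - cell_center d x)); last first.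
  by rewrite opprB addrCA addrA.
apply: (le_trans (rot_displacement _ sd)).
rewrite normrM normfV (gtr0_norm d0).
have -> : 2 * `|s| = 4 * (`|s| / d) * (d / 2) by field; rewrite gt_eqF.
by apply: ler_wpM2l; [rewrite mulr_ge0// divr_ge0// ltW|exact: ltW].
Qed.

Lemma measurable_fibers_cell_index d :
  measurable_fibers (cell_index d : mR * mR -> _).
Proof.
apply: measurable_fibers_pair; apply: measurable_fibers_floor;
  by apply: measurable_funD => //; apply: measurable_funM.
Qed.

Lemma measurable_cell_center d : 0 < d ->
  measurable_fun setT (cell_center d : mR * mR -> mR * mR).
Proof.
move=> d0; exact: (measurable_comp_fibers _ (@measurable_fibers_cell_index d)).
Qed.

Lemma measurable_norm_pair disp (T : measurableType disp) (p : T -> mR * mR) :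
  measurable_fun setT p -> measurable_fun setT (fun z => `|p z : R * R| : mR).
Proof.
move=> mp; apply: measurable_maxr; apply: measurableT_comp => //.
- exact: measurable_coord1.
- exact: measurable_coord2.
Qed.

Lemma measurable_in_cell d : 0 < d -> measurable_fun setT (in_cell d : mR * mR -> bool).
Proof.
move=> d0; apply: measurable_and.
  exact: (measurable_comp_fibers (fun y => (2 %| y.1 + y.2)%Z)
    (@measurable_fibers_cell_index d)).
apply: measurable_fun_ltr => //; apply: measurable_norm_pair.
apply: measurable_addP => //; apply: measurable_oppP.
exact: measurable_cell_center.
Qed.

Lemma measurable_cell_rot disp (T : measurableType disp) d (s : T -> mR) (p : T -> mR * mR) :
  0 < d -> measurable_fun setT s -> measurable_fun setT p ->
  measurable_fun setT (fun z => cell_rot d (s z) (p z) : mR * mR).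
Proof.
move=> d0 ms mp; have mc := measurableT_comp (measurable_cell_center d0) mp.
apply: measurable_fun_ifT => //.
  exact: (measurableT_comp (measurable_in_cell d0) mp).
apply: measurable_addP => //; apply: measurable_rot; first exact: measurable_funM.
by apply: measurable_addP => //; exact: measurable_oppP.
Qed.

Lemma mp_cell_rot d s : 0 < d -> `|s| <= d / 2 -> mp_injection mu (cell_rot d s).
Proof.
move=> d0 hs; have mr t : measurable_fun setT (cell_rot d t : mR * mR -> mR * mR).
  exact: (@measurable_cell_rot _ _ d (cst t) id d0).
have hs' : `|- s| <= d / 2 by rewrite normrN.
split; last exact/can_inj/cell_rotK.
have sd : `|s / d| <= 1 / 2.
  by rewrite normrM normfV (gtr0_norm d0) ler_pdivrMr// mul1r mulrC.
pose code x := pickle (if in_cell d x then Some (cell_index d x) else None).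
apply: (@mp_piecewise _ _ _ mu code
  (fun n => if unpickle n is Some (Some y) then
     (fun p => p + lattice_point d y) \o (rot (s / d) \o (fun p => p + - lattice_point d y))
   else id) _ (cell_rot d (- s))) => //.
- rewrite (_ : code = fun x => if in_cell d x then pickle (Some (cell_index d x))
      else pickle (None : option (int * int))); last first.
    by apply/funext => x; rewrite /code; case: ifP.
  apply: measurable_fun_ifT => //; first exact: measurable_in_cell.
  exact: (measurable_comp_fibers (fun y => pickle (Some y)) (@measurable_fibers_cell_index d)).
- move=> n; case: unpickle => [[y|]|]; do ?exact: mp_id.
  exact/(mp_injection_comp (mp_add _))/(mp_injection_comp (mp_rot sd))/mp_add.
- by move=> x; rewrite /cell_rot /code; case: ifP => hx; rewrite pickleK//= addrC.
- exact: cell_rotK.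
- by move=> x; rewrite -{1}(opprK s) cell_rotK.
Qed.

End CellRotation.

(** * The field on the cells is the velocity of their rotation *)

Section FieldOnCells.
Context {R : realType}.
Implicit Types (d h : R) (x p : R * R).

Lemma wrotZ (c : R) p : 0 < c -> wrot (c *: p) = c *: wrot p.
Proof.
move=> c0; rewrite /wrot /= !normrM (gtr0_norm c0) !ltr_pM2l//.
by case: ltgtP => _; apply: pair_eq; rewrite /= ?scaler0 //; rewrite /GRing.scale /=; ring.
Qed.

Lemma depauw_wE p : depauw_w p = if `|p| < 1 / 2 then wrot p else 0.
Proof.
rewrite /depauw_w /wrot norm_pair_lt.
case: ltgtP => [h|h|h]; rewrite /=.
- case: (ltP `|p.1| (1 / 2)) => h1 //=.
  by rewrite (lt_trans h h1).
- case: (ltP `|p.2| (1 / 2)) => h1 /=; rewrite ?andbF //.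
  by rewrite (lt_trans h h1).
- by rewrite if_same.
Qed.

Lemma depauw_uE d x : 0 < d ->
  depauw_u (d^-1 *: x) =
    if in_cell d x then d^-1 *: wrot (x - cell_center d x) else 0.
Proof.
move=> d0; have d1 : 0 < d^-1 by rewrite invr_gt0.
have scE y : d^-1 *: x - (y.1%:~R, y.2%:~R) = d^-1 *: (x - lattice_point d y).
  rewrite scalerBr; congr (_ - _); apply: pair_eq; rewrite /= /GRing.scale /=;
    by rewrite mulKf ?gt_eqF.
have nE y : (`|d^-1 *: (x - lattice_point d y)| < 1 / 2) = (`|x - lattice_point d y| < d / 2).
  by rewrite normrZ (gtr0_norm d1) mulrC ltr_pdivrMr// mul1r mulrC.
have wE y : depauw_w (d^-1 *: x - (y.1%:~R, y.2%:~R)) =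
    if `|x - lattice_point d y| < d / 2 then d^-1 *: wrot (x - lattice_point d y) else 0.
  by rewrite scE depauw_wE nE wrotZ.
rewrite /depauw_u; under eq_fsbigr do rewrite wE.
have [hx|hx] := boolP (in_cell d x).
  have /andP[par nx] := hx.
  rewrite -(@fsbig_widen _ _ _ _ [set cell_index d x]).
  - by rewrite fsbig_set1 nx.
  - by move=> _ ->.
  - move=> y [_ /= yx]; case: ifP => // /(cell_indexE d0) ex.
    by case: yx.
rewrite fsbig1// => y yev; case: ifP => // nx.
by move: hx; rewrite /in_cell /cell_center (cell_indexE d0 nx) nx andbT; move/negP.
Qed.

(** The points of the moving cells where a trajectory may turn a corner. The field also jumps at the
    borders of the cells, but no trajectory crosses them. *)
Definition on_diagonal d x : bool :=
  let p := x - cell_center d x in in_cell d x && (`|p.1| == `|p.2|).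

Lemma cell_rot_field d x : 0 < d -> ~~ on_diagonal d x ->
  exists2 e, 0 < e & forall h, `|h| <= e ->
    cell_rot d h x = x + h *: depauw_u (d^-1 *: x).
Proof.
move=> d0; rewrite depauw_uE// /on_diagonal.
have [hx|hx] := boolP (in_cell d x); last first.
  by exists 1 => // h _; rewrite cell_rot_out// scaler0 addr0.
rewrite /=; set p := x - _ => pd.
have g0 : 0 < `| `|p.1| - `|p.2| | by rewrite normr_gt0 subr_eq0.
(* The bound [d / 2] allows at most a quarter turn. The other one keeps the displacement, at most 2
   |h|, within the gap between the moduli of the coordinates, as [rot_wrot] requires. *)
exists (Num.min (d / 2) (`| `|p.1| - `|p.2| | / 2)).
  by rewrite lt_min !divr_gt0.
move=> h; rewrite le_min => /andP[h1 h2].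
rewrite /cell_rot hx -/p rot_wrot.
- by rewrite addrA addrCA subrr addr0 scalerA mulrC.
- by rewrite normrM normfV (gtr0_norm d0) ler_pdivrMr// mul1r mulrC.
- have /andP[_ nx] := hx; rewrite normrM normfV (gtr0_norm d0).
  apply: (@le_trans _ _ (4 * (`|h| / d) * (d / 2))).
    by apply: ler_wpM2l; [rewrite mulr_ge0// divr_ge0// ltW|exact: ltW].
  have -> : 4 * (`|h| / d) * (d / 2) = `|h| * 2 by field; rewrite gt_eqF.
  by rewrite -ler_pdivlMr.
Qed.

End FieldOnCells.

(** * The diagonals are null *)

Section NullSets.
Context {R : realType}.
Local Notation mR := (measurableTypeR R).
Local Notation mu := (@leb2 R).

Lemma null_countable_sections (D : set (mR * mR)) : measurable D ->
  (forall a, countable (xsection D a)) -> mu D = 0%E.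
Proof.
move=> mD cD; rewrite /leb2 /product_measure1 integral0_eq// => a _ /=.
by apply: countable_lebesgue_measure0.
Qed.

Lemma measurable_on_diagonal (d : R) : 0 < d ->
  measurable_fun setT (on_diagonal d : mR * mR -> bool).
Proof.
move=> d0; apply: measurable_and; first exact: measurable_in_cell.
have mp : measurable_fun setT (fun x : mR * mR => x - cell_center d x : mR * mR).
  apply: measurable_addP => //; apply: measurable_oppP; exact: measurable_cell_center.
apply: measurable_fun_eqr; apply: measurableT_comp => //.
- exact: measurable_coord1.
- exact: measurable_coord2.
Qed.

Lemma measurable_bool disp (T : measurableType disp) (b : T -> bool) :
  measurable_fun setT b -> measurable [set x | b x].
Proof.
by move=> mb; rewrite (_ : [set x | b x] = b @^-1` [set true]);
  [exact: preimage_measurable|apply/seteqP; split].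
Qed.

Lemma on_diagonal_null (d : R) : 0 < d -> mu [set x | on_diagonal d x] = 0%E.
Proof.
move=> d0; apply: null_countable_sections.
  by apply: measurable_bool; exact: measurable_on_diagonal.
(* On a vertical line such a point is determined by its cell and by the choice of one of the two
   diagonals. *)
move=> a; apply: (@sub_countable _ _ _ (range (fun z : (int * int) * bool =>
    d * z.1.2%:~R + (-1) ^+ z.2 * (a - d * z.1.1%:~R)))); last first.
  exact: sub_countable (card_image_le _ _) (countableP _).
apply: subset_card_le => b; rewrite /xsection mksetE in_setE mksetE.
rewrite /on_diagonal /cell_center; move=> /andP[_].
case: (cell_index d (a, b)) => y1 y2.
rewrite eqr_norm2 => /orP[] /eqP /= e.
  by exists ((y1, y2), false) => //=; rewrite expr0 mul1r e addrC subrK.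
by exists ((y1, y2), true) => //=; rewrite expr1 mulN1r e opprK addrC subrK.
Qed.

End NullSets.

(** * Chessboards *)

Section Chessboard.
Context {R : realType}.
Local Notation mR := (measurableTypeR R).
Local Notation mu := (@leb2 R).
Implicit Types (d : R) (x p : R * R).

(** The squares have their corners at the lattice points, whereas the cells are centred there: a
    cell is cut into four quadrants of alternating colours. *)
Definition chess d x : bool := (2 %| Num.floor (x.1 / d) + Num.floor (x.2 / d))%Z.

Lemma chess_shift d x : 0 < d -> chess d (x + (d, 0)) = ~~ chess d x.
Proof.
move=> d0; rewrite /chess /= addr0 mulrDl divff ?gt_eqF// floorDrz// floor1.
move: (Num.floor _) (Num.floor _) => a b.
by lia.
Qed.

Lemma measurable_chess d : measurable_fun setT (chess d : mR * mR -> bool).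
Proof.
have mf : measurable_fibers (fun x : mR * mR => (Num.floor (x.1 / d), Num.floor (x.2 / d))).
  by apply: measurable_fibers_pair; apply: measurable_fibers_floor;
    apply: measurable_funM.
exact: (measurable_comp_fibers (fun y => (2 %| y.1 + y.2)%Z) mf).
Qed.

(** The lines at multiples of [d / 2] contain the borders of the cells and of the squares of both
    chessboards, of steps [d] and [d / 2]. *)
Definition on_grid d x : bool :=
  (2 * x.1 / d \is a Num.int) || (2 * x.2 / d \is a Num.int).

(** The time is negative because the flow is followed from time 1 down to 0; hence the clockwise
    turn. *)
Lemma rot_quarter_turn p : rot (- (1 / 2)) p = - quarter p.
Proof.
have h : `|- (1 / 2)| <= 1 / 2 :> R by rewrite normrN ger0_norm//; lra.
elim/(@sector_ind R): p => [[a b] hq|q IH]; last by rewrite rot_quarter// IH quarterN.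
have [-> _ _ _] := rot_sector h hq; move/andP: hq => /= [h1 h2].
rewrite /rot_right /turn /= ifF; last by apply/negbTE; rewrite -leNgt; lra.
case: ifP => [_|/negbT]; first by congr (- quarter _); apply: pair_eq => /=; lra.
by rewrite -leNgt => h3; apply: pair_eq => /=; rewrite ?opprK; lra.
Qed.

Lemma floor_small (z : int) (t : R) : - 1 < t < 1 ->
  Num.floor (z%:~R + t) = z + (if t < 0 then - 1 else 0).
Proof.
move=> /andP[t1 t2]; case: ifP => t0; apply: floor_def; rewrite ?addr0 !intrD /=.
  by apply/andP; split; lra.
by move/negbT: t0; rewrite -leNgt => t0; apply/andP; split; lra.
Qed.

Lemma cell_coordinate d u : 0 < d -> 2 * u / d \isn't a Num.int ->
  exists t : R, [/\ u = d * (Num.floor (u / d + 1 / 2))%:~R + d * t,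
    - (1 / 2) < t < 1 / 2 & t != 0].
Proof.
move=> d0 un; set z := Num.floor _; exists (u / d - z%:~R).
have uE : u = d * (u / d) by rewrite mulrC divfK// gt_eqF.
have /andP[z1 z2] := floor_itv (u / d + 1 / 2); rewrite -/z intrD in z1 z2.
split.
- by rewrite mulrBr -uE addrC subrK.
- apply/andP; split; last by lra.
  rewrite lt_neqAle; apply/andP; split; last by lra.
  apply/eqP => e; move/negP: un; apply.
  have -> : 2 * u / d = (2 * z - 1)%:~R by rewrite intrB intrM -mulrA; lra.
  exact: intr_int.
- apply/eqP => e; move/negP: un; apply.
  have -> : 2 * u / d = (2 * z)%:~R by rewrite intrM -mulrA; lra.
  exact: intr_int.
Qed.

Lemma even_floors (y1 y2 : int) (a b : bool) :
  (2 %| y1 + (if a then -1 else 0) + (y2 + if b then -1 else 0))%Z =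
  ((2 %| y1 + y2)%Z == (a == b)).
Proof. by case: a; case: b; apply/idP/eqP; lia. Qed.

Lemma even_doubles (y1 y2 : int) : (2 %| 2 * y1 + 2 * y2)%Z.
Proof. lia. Qed.

(* On an even cell the quarter turn swaps the two colours of the quadrants; on
   an odd cell nothing moves, and there the finer chessboard is the complement
   of the coarse one. *)
Lemma chess_flip d x : 0 < d -> ~~ on_grid d x ->
  chess (d / 2) (cell_rot d (- (d / 2)) x) = ~~ chess d x.
Proof.
move=> d0; case: x => u v; rewrite negb_or /= => /andP[un vn].
have [t [uE ht t0]] := cell_coordinate d0 un.
have [w [vE hw w0]] := cell_coordinate d0 vn.
have cE : cell_index d (u, v) = (Num.floor (u / d + 1 / 2), Num.floor (v / d + 1 / 2)).
  by [].
move: uE vE cE; move: (Num.floor _) => y1; move: (Num.floor _) => y2 uE vE cE.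
have pE : (u, v) - lattice_point d (y1, y2) = (d * t, d * w).
  by apply: pair_eq => /=; [rewrite uE|rewrite vE]; ring.
(* In units of [d / 2] the cell centres are even, so the fine chessboard sees only the quadrant of a
   point, not the parity of its cell. *)
have d2 (z : int) (r : R) : (d * z%:~R + d * r) / (d / 2) = (2 * z)%:~R + 2 * r.
  by rewrite intrM; field; rewrite gt_eqF.
have d1 (z : int) (r : R) : (d * z%:~R + d * r) / d = z%:~R + r.
  by field; rewrite gt_eqF.
have inE : in_cell d (u, v) = (2 %| y1 + y2)%Z.
  rewrite /in_cell /cell_center cE pE norm_pair_lt /= !normrM (gtr0_norm d0).
  have ltd (r : R) : (d * `|r| < d / 2) = (`|r| < 1 / 2).
    by rewrite -[RHS](ltr_pM2l d0) mul1r.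
  by rewrite !ltd !ltr_norml ht hw !andbT.
have sg (r : R) : r != 0 -> (- r < 0) = ~~ (r < 0).
  by move=> r0; rewrite oppr_lt0 -leNgt lt_neqAle eq_sym r0.
move/andP: ht => [t1 t2]; move/andP: hw => [w1 w2].
(* The coarse colour is the parity of the cell, reversed in the two quadrants where exactly one
   coordinate is negative. *)
have -> : chess d (u, v) = ((2 %| y1 + y2)%Z == ((t < 0) == (w < 0))).
  rewrite /chess /= {1}uE {1}vE !d1 !floor_small; try by apply/andP; split; lra.
  exact: even_floors.
rewrite /cell_rot inE; case: ifP => ev.
  have -> : - (d / 2) / d = - (1 / 2) by field; rewrite gt_eqF.
  rewrite rot_quarter_turn /cell_center cE pE /chess /=.
  rewrite opprK -mulrN !d2 !floor_small; try by apply/andP; split; lra.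
  by rewrite even_floors even_doubles !pmulr_rlt0// sg//; case: (t < 0); case: (w < 0).
rewrite /chess /= {1}uE {1}vE !d2 !floor_small; try by apply/andP; split; lra.
by rewrite even_floors even_doubles !pmulr_rlt0//; case: (t < 0); case: (w < 0).
Qed.

Lemma measurable_is_int (r : mR * mR -> mR) : measurable_fun setT r ->
  measurable_fun setT (fun x => (r x : R) \is a Num.int).
Proof.
move=> mr; rewrite (_ : (fun _ => _) = (fun x => (Num.floor (r x : R))%:~R == (r x : R))).
  apply: measurable_fun_eqr => //.
  exact: (measurable_comp_fibers (fun z => z%:~R : mR) (measurable_fibers_floor mr)).
by apply/funext => x; rewrite intrEfloor.
Qed.

Lemma measurable_on_grid d : measurable_fun setT (on_grid d : mR * mR -> bool).
Proof.
by apply: measurable_or; apply: measurable_is_int; apply: measurable_funM => //;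
  apply: measurable_funM.
Qed.

Lemma on_grid_null d : 0 < d -> mu [set x | on_grid d x] = 0%E.
Proof.
move=> d0; pose D := [set x : mR * mR | (2 * x.2 / d : R) \is a Num.int].
have mD : measurable D.
  apply: measurable_bool; apply: measurable_is_int.
  by apply: measurable_funM => //; apply: measurable_funM.
have D0 : mu D = 0%E.
  apply: null_countable_sections => // a.
  apply: (@sub_countable _ _ _ (range (fun z : int => d * (z%:~R / 2) : mR))).
    apply: subset_card_le => b; rewrite /xsection mksetE in_setE /D mksetE /=.
    by move=> /intrP[z bz]; exists z => //; rewrite -bz; field; rewrite gt_eqF.
  exact: sub_countable (card_image_le _ _) (countableP _).
have [[_ sw] _] := @mp_swap R.
have D0' : mu (swap2 @^-1` D) = 0%E := etrans (sw D mD) D0.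
rewrite (_ : [set x | on_grid d x] = swap2 @^-1` D `|` D); last first.
  by apply/seteqP; split=> x /orP.
have msD : measurable (swap2 @^-1` D) by apply: preimage_measurable measurable_swap2 _.
apply: measure_negligible; first exact: measurableU.
by apply: negligibleU; apply/negligibleP.
Qed.

End Chessboard.

(** * The flow *)

Section DyadicLimits.
Context {R : realType}.
Implicit Types (a : R^nat).

Lemma half_pow_gt0 n : (0 : R) < 2 ^- n.
Proof. by rewrite invr_gt0 exprn_gt0. Qed.

Lemma half_powS n : (2 : R) ^- n.+1 = 2 ^- n / 2.
Proof. by rewrite exprSr invfM. Qed.

Lemma cvg_half_pow : ((2 : R) ^- n) @[n --> \oo] --> (0 : R).
Proof.
under eq_fun do rewrite -exprVn; apply: cvg_expr.
by rewrite ger0_norm ?invr_ge0// invf_lt1// ltr1n.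
Qed.

(** The geometric tail from [n] on is [2 * 2 ^- n]; subtracting and adding it yields an increasing
    lower and a decreasing upper envelope. *)
Lemma dyadic_cvg a : (forall n, `|a n.+1 - a n| <= 2 ^- n) ->
  cvgn a /\ forall n, `|limn a - a n| <= 2 * 2 ^- n.
Proof.
move=> ha.
pose lo n := a n - 2 * 2 ^- n; pose up n := a n + 2 * 2 ^- n.
have lo_nd : nondecreasing_seq lo.
  apply/nondecreasing_seqP => n; have := ha n; rewrite ler_norml /lo half_powS.
  by move=> /andP[? ?]; lra.
have up_ni : nonincreasing_seq up.
  apply/nonincreasing_seqP => n; have := ha n; rewrite ler_norml /up half_powS.
  by move=> /andP[? ?]; lra.
have lo_up n m : lo n <= up m.
  apply: (@le_trans _ _ (lo (maxn n m))); first exact/lo_nd/leq_maxl.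
  apply: (@le_trans _ _ (up (maxn n m))); last exact/up_ni/leq_maxr.
  by rewrite /lo /up; have := half_pow_gt0 (maxn n m); lra.
have cdel : (2 * 2 ^- n : R) @[n --> \oo] --> (0 : R).
  by rewrite -(mulr0 2); apply: cvgMr; exact: cvg_half_pow.
have clo : cvgn lo.
  by apply: (nondecreasing_is_cvgn lo_nd); exists (up 0%N) => _ [n _ <-].
have ca : a n @[n --> \oo] --> limn lo.
  rewrite (_ : a = fun n => lo n + 2 * 2 ^- n); last first.
    by apply/funext => n; rewrite /lo subrK.
  by rewrite -[limn lo]addr0; apply: cvgD.
split; first by apply/cvg_ex; exists (limn lo).
move=> n; rewrite (cvg_lim _ ca)// ler_norml; apply/andP; split.
  by have := nondecreasing_cvgn_le lo_nd clo n; rewrite /lo; lra.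
have : limn lo <= up n by apply: limr_le => //; apply: nearW => m; exact: lo_up.
by rewrite /up; lra.
Qed.

End DyadicLimits.

Arguments half_pow_gt0 : clear implicits.

Section Flow.
Context {R : realType}.
Local Notation mR := (measurableTypeR R).
Local Notation mu := (@leb2 R).
Implicit Types (s t h : R) (x z : R * R) (n k : nat).

Ltac case_minmax := repeat match goal with
  | |- context [Order.min ?a ?b] => case: (leP a b) => ?
  | |- context [Order.max ?a ?b] =>
      lazymatch b with context [Order.min _ _] => fail | _ => case: (leP a b) => ? end
  end.

(* The signed time spent in the n-th dyadic time interval [2^-n.+1, 2^-n] when
   going from time 1 to time t. *)
Definition clip n t : R := Num.max (2 ^- n.+1) (Num.min (2 ^- n) t) - 2 ^- n.

(** Only the first [n] dyadic intervals below time 1 act: for t below 2^-n the particle stays where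
    it was at time 2^-n. *)
Fixpoint flow_upto n t z : R * R :=
  if n is m.+1 then cell_rot (2 ^- m) (clip m t) (flow_upto m t z) else z.

Fixpoint flow_upto_inv n t x : R * R :=
  if n is m.+1 then flow_upto_inv m t (cell_rot (2 ^- m) (- clip m t) x) else x.

(* The position at time t of the particle located at z at time 1. *)
Definition flow t z : R * R :=
  (limn (fun n => (flow_upto n t z).1), limn (fun n => (flow_upto n t z).2)).

Lemma clip_bound n t : - (2 ^- n / 2) <= clip n t <= 0.
Proof.
rewrite /clip half_powS; have := half_pow_gt0 R n; move: (2 ^- n) => d d0.
by apply/andP; split; case_minmax; lra.
Qed.

Lemma norm_clip n t : `|clip n t| <= 2 ^- n / 2.
Proof.
have /andP[? ?] := clip_bound n t; have := half_pow_gt0 R n.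
by rewrite ler_norml => ?; apply/andP; split; lra.
Qed.

Lemma clip_ge n t : 2 ^- n <= t -> clip n t = 0.
Proof.
move=> h; rewrite /clip (min_idPl h) (max_idPr _) ?subrr// half_powS.
by have := half_pow_gt0 R n; lra.
Qed.

Lemma clip_le n t : t <= 2 ^- n.+1 -> clip n t = - (2 ^- n / 2).
Proof.
move=> h; have := half_pow_gt0 R n; rewrite /clip half_powS => ?.
rewrite (max_idPl _); first by lra.
by rewrite ge_min -half_powS h orbT.
Qed.

Lemma clip_in n t : 2 ^- n.+1 <= t <= 2 ^- n -> clip n t = t - 2 ^- n.
Proof. by move=> /andP[h1 h2]; rewrite /clip (min_idPr h2) (max_idPr h1). Qed.

Lemma flow_upto_displacement n t z :
  `|flow_upto n.+1 t z - flow_upto n t z| <= 2 ^- n.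
Proof.
apply: (le_trans (cell_rot_displacement _ (half_pow_gt0 R n) (norm_clip n t))).
by have := norm_clip n t; lra.
Qed.

Lemma norm_fst x : `|x.1| <= `|x|.
Proof. by rewrite norm_pair le_max lexx. Qed.

Lemma norm_snd x : `|x.2| <= `|x|.
Proof. by rewrite norm_pair le_max lexx orbT. Qed.

Lemma flow_cvg t z :
  [/\ (flow_upto n t z).1 @[n --> \oo] --> (flow t z).1,
      (flow_upto n t z).2 @[n --> \oo] --> (flow t z).2 &
      forall n, `|flow t z - flow_upto n t z| <= 2 * 2 ^- n].
Proof.
have [c1 b1] := @dyadic_cvg R (fun n => (flow_upto n t z).1)
  (fun n => le_trans (norm_fst _) (flow_upto_displacement n t z)).
have [c2 b2] := @dyadic_cvg R (fun n => (flow_upto n t z).2)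
  (fun n => le_trans (norm_snd _) (flow_upto_displacement n t z)).
by split => // n; rewrite norm_pair_le b1 b2.
Qed.

Lemma half_pow_le n m : (n <= m)%N -> (2 : R) ^- m <= 2 ^- n.
Proof. by move=> nm; rewrite lef_pV2 ?posrE ?exprn_gt0// ler_eXn2l// ltr1n. Qed.

Lemma flow_upto_stable n m t z : 2 ^- n <= t -> (n <= m)%N ->
  flow_upto m t z = flow_upto n t z.
Proof.
move=> nt /subnK <-; elim: (m - n)%N => // j IH; rewrite addSn /= IH clip_ge ?cell_rot0//.
exact: le_trans (half_pow_le (leq_addl _ _)) nt.
Qed.

Lemma flowE n t z : 2 ^- n <= t -> flow t z = flow_upto n t z.
Proof.
move=> nt; have [c1 c2 _] := flow_cvg t z.
have E : \forall m \near \oo, flow_upto m t z = flow_upto n t z.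
  by exists n => // m /= nm; exact: flow_upto_stable.
apply: pair_eq.
  apply: (cvg_unique _ c1) => //; apply: cvg_near_cst.
  by apply: filterS E => m ->.
apply: (cvg_unique _ c2) => //; apply: cvg_near_cst.
by apply: filterS E => m ->.
Qed.

Lemma flow_upto_saturated n s t z : s <= 2 ^- n -> t <= 2 ^- n ->
  flow_upto n s z = flow_upto n t z.
Proof.
elim: n => //= n IH sn tn; rewrite !clip_le//; congr cell_rot; apply: IH;
  apply: le_trans (half_pow_le (leqnSn _)); done.
Qed.

Lemma flow_upto_lipschitz n s t z :
  `|flow_upto n t z - flow_upto n s z| <= 2 * `|t - s|.
Proof.
wlog st : s t / s <= t.
  move=> H; case: (leP s t) => [|/ltW] ts; first exact: H.
  by rewrite distrC [X in _ * X]distrC; exact: H.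
(* The sharper bound counts only the time spent above 2^-n, in which alone [flow_upto n] moves; the
   induction needs it so that the increments of the single steps add up. *)
suff : `|flow_upto n t z - flow_upto n s z| <=
    2 * (Num.max (2 ^- n) t - Num.max (2 ^- n) s).
  move/le_trans; apply; rewrite ger0_norm ?subr_ge0// ler_pM2l//.
  by case_minmax; lra.
elim: n => [|n IH] /=.
  rewrite subrr normr0 mulr_ge0// subr_ge0; case_minmax; lra.
have d0 := half_pow_gt0 R n.
have [ns|sn] := leP (2 ^- n) s.
  rewrite !clip_ge ?cell_rot0// ?(le_trans ns)//; apply: (le_trans IH).
  by rewrite half_powS; case_minmax; lra.
have [nt|tn] := leP (2 ^- n) t.
  rewrite (clip_ge nt) cell_rot0.
  have D := cell_rot_displacement (flow_upto n s z) d0 (norm_clip n s).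
  rewrite -[X in `|X|](subrKA (flow_upto n s z)) (le_trans (ler_normD _ _))//.
  rewrite [X in _ + X]distrC; apply: le_trans (lerD IH D) _.
  have /andP[_ c0] := clip_bound n s; rewrite (ler0_norm c0).
  have d2 : 2 ^- n / 2 <= t by apply: le_trans nt; lra.
  rewrite /clip half_powS (min_idPr (ltW sn)) (max_idPr nt) (max_idPl (ltW sn)) (max_idPr d2).
  by lra.
(* Below 2^-n both positions come from the same point by rotations of the same cells, hence from
   each other by one rotation. *)
rewrite (@flow_upto_saturated n s t) ?(ltW sn)// ?(ltW tn)//.
set w := flow_upto n t z.
have D : `|clip n t - clip n s| <= 2 ^- n / 2.
  have /andP[? ?] := clip_bound n s; have /andP[? ?] := clip_bound n t.
  by rewrite ler_norml; apply/andP; split; lra.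
have -> : cell_rot (2 ^- n) (clip n t) w =
    cell_rot (2 ^- n) (clip n t - clip n s) (cell_rot (2 ^- n) (clip n s) w).
  by rewrite -cell_rotD ?norm_clip// addrC subrK ?norm_clip.
apply: (le_trans (cell_rot_displacement _ d0 D)).
rewrite ler_pM2l// /clip half_powS (min_idPr (ltW sn)) (min_idPr (ltW tn)).
rewrite opprB addrA addrNK ger0_norm// subr_ge0 ge_max !le_max lexx st orbT andbT.
by rewrite orTb.
Qed.

Lemma flow_lipschitz s t z : `|flow t z - flow s z| <= 2 * `|t - s|.
Proof.
have [t1 t2 _] := flow_cvg t z; have [s1 s2 _] := flow_cvg s z.
rewrite norm_pair_le; apply/andP; split.
  have c : `|(flow_upto n t z).1 - (flow_upto n s z).1| @[n --> \oo] -->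
    `|(flow t z).1 - (flow s z).1| by apply: cvg_norm; exact: cvgB.
  rewrite -(cvg_lim _ c)//; apply: limr_le; first by apply/cvg_ex; eexists; exact: c.
  by apply: nearW => n; apply: le_trans (norm_fst _) (flow_upto_lipschitz n s t z).
have c : `|(flow_upto n t z).2 - (flow_upto n s z).2| @[n --> \oo] -->
  `|(flow t z).2 - (flow s z).2| by apply: cvg_norm; exact: cvgB.
rewrite -(cvg_lim _ c)//; apply: limr_le; first by apply/cvg_ex; eexists; exact: c.
by apply: nearW => n; apply: le_trans (norm_snd _) (flow_upto_lipschitz n s t z).
Qed.

Lemma flow_ge1 t z : 1 <= t -> flow t z = z.
Proof. by move=> t1; rewrite (@flowE 0) // expr0 invr1. Qed.

Lemma flow_near_start t z : `|flow t z - z| <= 2.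
Proof. by have [_ _ /(_ 0%N)] := flow_cvg t z; rewrite /= expr0 invr1 mulr1. Qed.

Lemma flow_upto_invK n t : cancel (flow_upto n t) (flow_upto_inv n t).
Proof.
by elim: n => // n IH z; rewrite /= (cell_rotK (half_pow_gt0 _ _) (norm_clip _ _)) IH.
Qed.

Lemma measurable_clip n : measurable_fun setT (clip n : mR -> mR).
Proof.
by apply: measurable_funB => //; apply: measurable_maxr => //; exact: measurable_minr.
Qed.

Lemma measurable_flow_upto_inv n disp (T : measurableType disp)
    (t : T -> mR) (p : T -> mR * mR) :
  measurable_fun setT t -> measurable_fun setT p ->
  measurable_fun setT (fun w => flow_upto_inv n (t w) (p w) : mR * mR).
Proof.
move=> mt; elim: n p => //= n IH p mp; apply: IH.
apply: (measurable_cell_rot (half_pow_gt0 _ _)) => //.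
by apply: measurable_funN; exact: measurableT_comp (measurable_clip n) mt.
Qed.

Lemma mp_flow_upto n t : mp_injection mu (flow_upto n t).
Proof.
elim: n => [|n IH]; first exact: mp_id.
apply: (mp_injection_comp _ IH).
exact: (mp_cell_rot (half_pow_gt0 R n) (norm_clip n t)).
Qed.

Lemma measurable_flow t : measurable_fun setT (flow t : mR * mR -> mR * mR).
Proof.
have m n : measurable_fun setT (flow_upto n t : mR * mR -> mR * mR).
  exact: (mp_flow_upto n t).1.1.
apply: measurable_pairing.
- apply: (@measurable_fun_cvg _ _ _ setT (fun n z => (flow_upto n t z).1)) => [n|z _].
    exact: (measurable_coord1 (m n)).
  by have [] := flow_cvg t z.
- apply: (@measurable_fun_cvg _ _ _ setT (fun n z => (flow_upto n t z).2)) => [n|z _].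
    exact: (measurable_coord2 (m n)).
  by have [] := flow_cvg t z.
Qed.

Lemma half_pow_lt_pos t : 0 < t -> exists n, 2 ^- n <= t.
Proof.
move=> t0; have /cvgrPdist_lt /(_ t t0) [n _ /(_ n (leqnn _)) H] := @cvg_half_pow R.
by exists n; rewrite sub0r normrN ger0_norm ?ltW ?half_pow_gt0// in H; exact: ltW.
Qed.

(** At a positive time the flow is a finite composition of rotations. Time 0 is a limit and is
    treated in [flow0_measure]. *)
Lemma mp_flow t : 0 < t -> measure_preserving mu (flow t).
Proof.
move=> /half_pow_lt_pos[n nt]; have [h _] := mp_flow_upto n t.
by rewrite (_ : flow t = flow_upto n t)//; apply/funext => z; exact: flowE.
Qed.

Lemma flow_semigroup k t h z : 2 ^- k.+1 < t < 2 ^- k -> 2 ^- k.+1 <= t + h <= 2 ^- k ->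
  flow (t + h) z = cell_rot (2 ^- k) h (flow t z).
Proof.
move=> /andP[t1 t2] /andP[h1 h2].
rewrite !(@flowE k.+1) ?(ltW t1)//= !clip_in ?h1 ?h2 ?ltW//.
rewrite -cell_rotD ?half_pow_gt0//.
- rewrite (@flow_upto_saturated k (t + h) t) ?(ltW t2)//.
  by congr cell_rot; ring.
- by rewrite ler_norml; move: h1 h2 t1 t2; rewrite half_powS => *; apply/andP; split; lra.
- by rewrite ler_norml; move: h1 h2 t1 t2; rewrite half_powS => *; apply/andP; split; lra.
- by rewrite ler_norml; move: h1 h2 t1 t2; rewrite half_powS => *; apply/andP; split; lra.
Qed.

Lemma depauw_b_slab k t x : 2 ^- k.+1 < t < 2 ^- k ->
  depauw_b (t, x) = depauw_u (2 ^+ k *: x).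
Proof.
move=> tk; rewrite /depauw_b (_ : [set k | _] = [set k]) ?fsbig_set1//.
apply/seteqP; split=> j /=; last by move=> ->.
move=> /andP[j1 j2]; move/andP: tk => [k1 k2].
case: (ltngtP j k) => // jk; exfalso.
  by have := lt_le_trans j1 (le_trans (ltW k2) (half_pow_le jk)); rewrite ltxx.
by have := lt_le_trans k1 (le_trans (ltW j2) (half_pow_le jk)); rewrite ltxx.
Qed.

Lemma depauw_b_gt1 t x : 1 < t -> depauw_b (t, x) = 0.
Proof.
move=> t1; rewrite /depauw_b (_ : [set k | _] = set0) ?fsbig_set0//.
apply/seteqP; split=> j //= /andP[_ tj].
have := @half_pow_le 0 j isT; rewrite expr0 invr1 => j1.
by have := lt_trans t1 (lt_le_trans tj j1); rewrite ltxx.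
Qed.

Lemma slab_exists t : 0 < t < 1 -> (forall k, t != 2 ^- k) ->
  exists k, 2 ^- k.+1 < t < 2 ^- k.
Proof.
move=> /andP[t0 t1] tk; have ex := half_pow_lt_pos t0.
case: (ex_minnP ex) => -[|k]; first by rewrite expr0 invr1 leNgt t1.
move=> kt kmin; exists k; rewrite lt_neqAle eq_sym tk kt /=.
by rewrite ltNge; apply/negP => /kmin; rewrite ltnn.
Qed.

Lemma flow_field k t z : 2 ^- k.+1 < t < 2 ^- k ->
  ~~ on_diagonal (2 ^- k) (flow t z) ->
  exists2 e, 0 < e & forall h, `|h| <= e ->
    flow (t + h) z = flow t z + h *: depauw_b (t, flow t z).
Proof.
move=> tk nd; have [e e0 eE] := cell_rot_field (half_pow_gt0 _ k) nd.
rewrite (depauw_b_slab _ tk); rewrite invrK in eE.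
have /andP[k1 k2] := tk.
exists (Num.min e (Num.min (t - 2 ^- k.+1) (2 ^- k - t))).
  by rewrite !lt_min e0 !subr_gt0 k1 k2.
move=> h; rewrite !le_min => /and3P[h1 h2 h3]; rewrite -(eE _ h1).
apply: flow_semigroup => //; move: h2 h3; rewrite !ler_norml => /andP[? ?] /andP[? ?].
by apply/andP; split; lra.
Qed.

Lemma flow_field_gt1 t z : 1 < t ->
  exists2 e, 0 < e & forall h, `|h| <= e ->
    flow (t + h) z = flow t z + h *: depauw_b (t, flow t z).
Proof.
move=> t1; exists (t - 1); first by rewrite subr_gt0.
move=> h; rewrite ler_norml => /andP[? ?]; rewrite depauw_b_gt1// scaler0 addr0.
by rewrite !flow_ge1//; lra.
Qed.

End Flow.

(** * Equidistribution of the two colours at time 0 *)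

Section Boxes.
Context {R : realType}.
Local Notation mR := (measurableTypeR R).
Implicit Types (a b c d e : R) (x y : R * R).

Definition box a b c d : set (mR * mR) :=
  [set x | (a <= x.1 <= b) /\ (c <= x.2 <= d)].

Definition boxes : set (set (mR * mR)) :=
  [set A | exists a b c d, A = box a b c d].

Lemma boxE a b c d : box a b c d = `[a, b] `*` `[c, d].
Proof. by apply/seteqP; split=> x; rewrite /= !in_itv /=. Qed.

Lemma measurable_box a b c d : measurable (box a b c d).
Proof. by rewrite boxE; apply: measurableX; exact: measurable_itv. Qed.

Lemma box_thicken a b c d e r x y : box (a - e) (b + e) (c - e) (d + e) x ->
  `|y - x| <= r -> box (a - (e + r)) (b + (e + r)) (c - (e + r)) (d + (e + r)) y.
Proof.
move=> /= [/andP[? ?] /andP[? ?]]; rewrite norm_pair_le /= !ler_norml.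
move=> /andP[/andP[? ?] /andP[? ?]].
by split; apply/andP; split; lra.
Qed.

Lemma box_ge_bound x : exists n : nat, forall m, (n <= m)%N ->
  box (- m%:R) m%:R (- m%:R) m%:R x.
Proof.
exists (Num.bound `|x|) => m nm.
have : `|x| <= m%:R.
  by apply: ltW; apply: lt_le_trans (archi_boundP (normr_ge0 _)) _; rewrite ler_nat.
by rewrite norm_pair_le !ler_norml => /andP[].
Qed.

Lemma bigcup_box : \bigcup_n box (- n%:R) n%:R (- n%:R) n%:R = [set: mR * mR].
Proof.
by apply/seteqP; split=> // x _; have [n H] := box_ge_bound x; exists n => //; exact: H.
Qed.

(** The preimage of a half-line under a coordinate is the union of its traces on the boxes of radius
    n, and these traces are boxes. *)
Lemma measurable_boxes : @measurable _ (mR * mR)%type = <<s boxes >>.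
Proof.
apply/seteqP; split; last first.
  apply: smallest_sub; first exact: sigma_algebra_measurable.
  by move=> _ [a [b [c [d ->]]]]; exact: measurable_box.
have mG (f : g_sigma_algebraType boxes -> mR) :
    (forall a, f @^-1` `[a, +oo[ = \bigcup_n (f @^-1` `[a, +oo[ `&`
       box (- n%:R) n%:R (- n%:R) n%:R) /\
       forall n : nat, boxes (f @^-1` `[a, +oo[ `&`
       box (- n%:R) n%:R (- n%:R) n%:R)) ->
    measurable_fun setT f.
  move=> Hf; apply: (measurability _ (RGenCInfty.measurableE R)).
  move=> _ [_ [a ->] <-]; rewrite setTI; have [fE H] := Hf a; rewrite fE.
  apply: bigcupT_measurable => n; by apply: sub_sigma_algebra; exact: H.
have m1 : measurable_fun setT (fst : g_sigma_algebraType boxes -> mR).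
  apply: mG => a; split; first by rewrite -setI_bigcupr bigcup_box setIT.
  move=> n; exists (Num.max a (- n%:R)), n%:R, (- n%:R), n%:R.
  apply/seteqP; split=> x; rewrite /box /= in_itv /= andbT ge_max.
    by move=> [-> [/andP[-> ->] ->]].
  by move=> [/andP[/andP[-> ->] ->] ->].
have m2 : measurable_fun setT (snd : g_sigma_algebraType boxes -> mR).
  apply: mG => a; split; first by rewrite -setI_bigcupr bigcup_box setIT.
  move=> n; exists (- n%:R), n%:R, (Num.max a (- n%:R)), n%:R.
  apply/seteqP; split=> x; rewrite /box /= in_itv /= andbT ge_max.
    by move=> [-> [-> /andP[-> ->]]].
  by move=> [-> /andP[/andP[-> ->] ->]].
rewrite measurable_prod_measurableType; apply: smallest_sub.
  exact: smallest_sigma_algebra.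
move=> _ [A mA [B mB <-]].
rewrite (_ : A `*` B = (fst @^-1` A) `&` (snd @^-1` B))//.
by apply: (@measurableI _ (g_sigma_algebraType boxes)); exact: preimage_measurable.
Qed.

Lemma measure_eq_boxes (m1 m2 : {measure set (mR * mR) -> \bar R}) :
  (forall a b c d, m1 (box a b c d) = m2 (box a b c d)) ->
  (forall a b c d, m1 (box a b c d) < +oo)%E ->
  forall A, measurable A -> m1 A = m2 A.
Proof.
move=> m12 fin A mA.
apply: (measure_unique boxes (fun n => box (- n%:R) n%:R (- n%:R) n%:R)) => //.
- exact: measurable_boxes.
- move=> _ _ [a [b [c [d ->]]]] [a' [b' [c' [d' ->]]]].
  exists (Num.max a a'), (Num.min b b'), (Num.max c c'), (Num.min d d').
  apply/seteqP; split=> x; rewrite /box /= !ge_max !le_min.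
    by move=> [[/andP[-> ->] /andP[-> ->]] [/andP[-> ->] /andP[-> ->]]].
  by move=> [/andP[/andP[-> ->] /andP[-> ->]] /andP[/andP[-> ->] /andP[-> ->]]].
- by move=> n; do 4!eexists.
- exact: bigcup_box.
- by move=> _ [a [b [c [d ->]]]].
Qed.

Definition thick a b c d e := box (a - e) (b + e) (c - e) (d + e).

(* Boxes are closed, hence the intersection of their thickenings. *)
Lemma le_measure_thick (m : {measure set (mR * mR) -> \bar R}) a b c d (r : R) (v : \bar R) :
  0 <= r -> (forall a b c d, m (box a b c d) < +oo)%E ->
  (forall n, v <= m (thick a b c d (r * 2 ^- n)))%E -> (v <= m (box a b c d))%E.
Proof.
move=> r0 fin vle; pose F n := thick a b c d (r * 2 ^- n).
have FE : \bigcap_n F n = box a b c d.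
  apply/seteqP; split=> x; last first.
    move=> /= [/andP[? ?] /andP[? ?]] n _; have : 0 <= r * 2 ^- n.
      by rewrite mulr_ge0// ltW// half_pow_gt0.
    by split; apply/andP; split; lra.
  move=> H.
  have lim (u w : R) : (forall n, u <= w + r * 2 ^- n) -> u <= w.
    move=> uw; have c0 : (w + r * 2 ^- n) @[n --> \oo] --> w.
      rewrite -[X in _ --> X]addr0; apply: cvgD; first exact: cvg_cst.
      by rewrite -(mulr0 r); apply: cvgMr; exact: cvg_half_pow.
    rewrite -(cvg_lim _ c0)//; apply: limr_ge; first by apply/cvg_ex; exists w.
    exact: nearW.
  by split; apply/andP; split; apply: lim => n; have [/andP[? ?] /andP[? ?]] := H n I; lra.
rewrite -FE; have cF : (m \o F) n @[n --> \oo] --> m (\bigcap_n F n).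
  apply: nonincreasing_cvg_mu => //.
  - exact: fin.
  - by move=> n; exact: measurable_box.
  - by rewrite FE; exact: measurable_box.
  move=> i j ij; apply/subsetPset => x.
  have : r * 2 ^- j <= r * 2 ^- i by apply: ler_wpM2l => //; exact: half_pow_le.
  by move=> h /= [/andP[? ?] /andP[? ?]]; split; apply/andP; split; lra.
rewrite -(cvg_lim _ cF)//; apply: lime_ge; first by apply/cvg_ex; eexists; exact: cF.
exact: nearW.
Qed.

End Boxes.

Lemma measurable_bool_eq disp (T : measurableType disp) (b : T -> bool) (s : bool) :
  measurable_fun setT b -> measurable [set x | b x == s].
Proof.
move=> mb; apply: measurable_bool; case: s.
  by rewrite (_ : (fun x => b x == true) = b)//; apply/funext => x; rewrite eqb_id.
rewrite (_ : (fun x => b x == false) = (fun x => ~~ b x)); first exact: measurable_neg.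
by apply/funext => x; rewrite eqbF_neg.
Qed.

(** * The images of the two colours under the flow at time 0 *)

Section ColouredLimit.
Context {R : realType}.
Local Notation mR := (measurableTypeR R).
Local Notation mu := (@leb2 R).
Implicit Types (a b c d e : R) (x z : mR * mR) (s : bool).

Definition colour s : set (mR * mR) := [set z | chess 1 z == s].

Lemma measurable_colour s : measurable (colour s).
Proof.
by apply: measurable_bool_eq; exact: measurable_chess.
Qed.

Lemma le_measure_mod_null disp (T : measurableType disp) (m : {measure set T -> \bar R})
    (A B N : set T) : measurable A -> measurable B -> measurable N ->
  m N = 0%E -> A `<=` B `|` N -> (m A <= m B)%E.
Proof.
move=> mA mB mN N0 AB; rewrite -[leRHS]adde0 -[X in (_ <= _ + X)%E]N0.
apply: le_trans _ (measureU2 m mB mN).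
by apply: le_measure; rewrite ?inE //; exact: measurableU.
Qed.

(** Every step reverses the colour by [chess_flip], whence the parity of [n]; the null set collects
    the particles that meet the grid of one of the steps. *)
Lemma chess_flow_upto n : exists N : set (mR * mR), [/\ measurable N, mu N = 0%E &
  forall z, ~ N z -> chess (2 ^- n) (flow_upto n 0 z) = chess 1 z (+) odd n].
Proof.
elim: n => [|n [N [mN N0 NE]]].
  by exists set0; split=> // z _; rewrite expr0 invr1 /= addbF.
have [[mf f1] _] := @mp_flow_upto R n 0.
pose G : set (mR * mR) := [set x | on_grid (2 ^- n) x].
have mG : measurable G by apply: measurable_bool; exact: measurable_on_grid.
have mfG : measurable (flow_upto n 0 @^-1` G) by exact: preimage_measurable.
exists (N `|` flow_upto n 0 @^-1` G); split.
- exact: measurableU.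
- apply: measure_negligible; first exact: measurableU.
  apply: negligibleU; apply/negligibleP => //.
  exact: (etrans (f1 G mG) (on_grid_null (half_pow_gt0 R n))).
- move=> z /not_orP[Nz Gz]; rewrite /= clip_le; last exact: ltW (half_pow_gt0 _ _).
  rewrite half_powS chess_flip ?half_pow_gt0//; last exact/negP.
  by rewrite NE// addbN.
Qed.

(** Translation by one square exchanges the colours and leaves the box by at most [d]. *)
Lemma chess_shift_measure d s a b c c' : 0 < d ->
  (mu (box a b c c' `&` [set x | chess d x == s]) <=
   mu (thick a b c c' d `&` [set x | chess d x == ~~ s]))%E.
Proof.
move=> d0.
have mch r : measurable [set x : mR * mR | chess d x == r].
  by apply: measurable_bool_eq; exact: measurable_chess.
have mT : measurable (thick a b c c' d `&` [set x | chess d x == ~~ s]).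
  by apply: measurableI => //; exact: measurable_box.
have [[mf f1] _] := @mp_add R (d, 0).
rewrite -[leRHS]f1//; apply: le_measure; rewrite ?inE.
- by apply: measurableI => //; exact: measurable_box.
- exact: preimage_measurable.
move=> x [/= [/andP[? ?] /andP[? ?]] xs]; split.
  by split; apply/andP; rewrite /=; split; lra.
by rewrite /= chess_shift// (eqP xs).
Qed.

(** The constant is 5 = 2 + 1 + 2: replacing [flow 0] by [flow_upto n] costs 2 * 2^-n, exchanging
    the colours by a translation costs one square 2^-n, and returning to [flow 0] costs 2 * 2^-n
    again. *)
Lemma colour_box_le s a b c d (n : nat) :
  (mu (colour s `&` flow 0 @^-1` box a b c d) <=
   mu (colour (~~ s) `&` flow 0 @^-1` thick a b c d (5 * 2 ^- n)))%E.
Proof.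
have [N [mN N0 NE]] := chess_flow_upto n.
have [[mf f1] _] := @mp_flow_upto R n 0.
have dist z : `|flow 0 z - flow_upto n 0 z| <= 2 * 2 ^- n by have [] := flow_cvg 0 z.
have dist' z : `|flow_upto n 0 z - flow 0 z| <= 2 * 2 ^- n by rewrite distrC.
have mb := @measurable_box R; have mc := measurable_colour.
have mt u : measurable (thick a b c d u) by exact: measurable_box.
have m0 (A : set (mR * mR)) : measurable A -> measurable (flow 0 @^-1` A).
  by apply: preimage_measurable; exact: measurable_flow.
pose C r : set (mR * mR) := [set x | chess (2 ^- n) x == r].
have mC r : measurable (C r).
  by apply: measurable_bool_eq; exact: measurable_chess.
pose s' := s (+) odd n.
apply: (@le_trans _ _ (mu (thick a b c d (2 * 2 ^- n) `&` C s'))).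
  have mI : measurable (thick a b c d (2 * 2 ^- n) `&` C s') by apply: measurableI.
  rewrite -[leRHS]f1//; apply: (le_measure_mod_null _ _ mN N0).
  - by apply: measurableI => //; exact: m0.
  - exact: preimage_measurable.
  move=> z [/eqP zs Kz]; have [Nz|Nz] := pselect (N z); first by right.
  left; split; last by rewrite /C /= NE// zs eqxx.
  move: Kz; rewrite -[box a b c d]/(box _ _ _ _) => Kz.
  have := @box_thicken R a b c d 0 (2 * 2 ^- n) (flow 0 z) (flow_upto n 0 z).
  by rewrite !subr0 !addr0 !add0r; apply.
apply: (le_trans (chess_shift_measure _ _ _ _ _ (half_pow_gt0 R n))).
pose e : R := 2 * 2 ^- n + 2 ^- n.
have -> : thick (a - 2 * 2 ^- n) (b + 2 * 2 ^- n) (c - 2 * 2 ^- n) (d + 2 * 2 ^- n) (2 ^- n) =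
    thick a b c d e by rewrite /thick /e; congr box; ring.
have mI : measurable (thick a b c d e `&` C (~~ s')) by apply: measurableI.
rewrite -[leLHS]f1//; apply: (le_measure_mod_null _ _ mN N0).
- exact: preimage_measurable.
- by apply: measurableI => //; exact: m0.
move=> z [Kz /eqP zs]; have [Nz|Nz] := pselect (N z); first by right.
left; split.
  by rewrite /colour /=; move: zs; rewrite NE// /s'; case: (chess 1 z) (s) (odd n) => -[] [].
have := @box_thicken R a b c d e (2 * 2 ^- n) _ _ Kz (dist z).
by rewrite (_ : e + 2 * 2 ^- n = 5 * 2 ^- n)// /e; ring.
Qed.

Lemma flow0_box_le a b c d (n : nat) :
  (mu (flow 0 @^-1` box a b c d) <= mu (thick a b c d (2 * 2 ^- n)))%E /\
  (mu (box a b c d) <= mu (flow 0 @^-1` thick a b c d (2 * 2 ^- n)))%E.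
Proof.
have [[mf f1] _] := @mp_flow_upto R n 0.
have dist z : `|flow 0 z - flow_upto n 0 z| <= 2 * 2 ^- n by have [] := flow_cvg 0 z.
have mb := @measurable_box R.
have mt u : measurable (thick a b c d u) by exact: measurable_box.
have m0 (A : set (mR * mR)) : measurable A -> measurable (flow 0 @^-1` A).
  by apply: preimage_measurable; exact: measurable_flow.
split.
  rewrite -[leRHS]f1; last exact: mb.
  apply: le_measure; rewrite ?inE; [exact: m0|exact: preimage_measurable|].
  move=> z Kz; have := @box_thicken R a b c d 0 (2 * 2 ^- n) (flow 0 z) (flow_upto n 0 z).
  by rewrite !subr0 !addr0 !add0r distrC; apply.
rewrite -[leLHS]f1; last exact: mb.
apply: le_measure; rewrite ?inE; [by apply: preimage_measurable|by apply: m0|].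
move=> z Kz; have := @box_thicken R a b c d 0 (2 * 2 ^- n) (flow_upto n 0 z) (flow 0 z).
by rewrite !subr0 !addr0 !add0r; apply.
Qed.

Lemma box_fin a b c d : (mu (box a b c d) < +oo)%E.
Proof.
have fin u v : (lebesgue_measure (`[u, v]%classic : set R) < +oo)%E.
  by rewrite lebesgue_measure_itv /=; case: ifP; rewrite ?ltry// -EFinB ltry.
rewrite boxE /leb2 product_measure1E//; apply: lte_mul_pinfty => //.
  by rewrite ge0_fin_numE//; exact: fin.
exact: fin.
Qed.

Lemma flow0_box_fin a b c d : (mu (flow 0 @^-1` box a b c d) < +oo)%E.
Proof. exact: le_lt_trans (flow0_box_le a b c d 0).1 (box_fin _ _ _ _). Qed.

(* Existentially quantified so that unification does not unfold the measure. *)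
Lemma image_measure (D : set (mR * mR)) : measurable D ->
  exists m : {measure set (mR * mR) -> \bar R},
    forall A, m A = mu (D `&` flow 0 @^-1` A).
Proof.
move=> mD; have mf : measurable_fun setT (flow 0 : mR * mR -> mR * mR).
  exact: measurable_flow.
pose m := measure_function_pushforward__canonical__measure_function_Measure
  [the {measure set (mR * mR) -> \bar R} of mrestr mu mD] mf.
by exists m => A; rewrite setIC.
Qed.

(** A uniform limit of measure preserving maps: the two measures compare both ways up to thickening,
    hence agree on closed boxes, which determine them. *)
Lemma flow0_measure (A : set (mR * mR)) : measurable A -> mu (flow 0 @^-1` A) = mu A.
Proof.
move=> mA; have [m mE] := image_measure measurableT.
have {}mE B : m B = mu (flow 0 @^-1` B) by rewrite mE setTI.
have [m' m'E] : exists m' : {measure set (mR * mR) -> \bar R}, forall B, m' B = mu B.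
  by exists mu.
have fin a b c d : (m (box a b c d) < +oo)%E by rewrite mE; exact: flow0_box_fin.
rewrite -mE -m'E; apply: measure_eq_boxes => // a b c d.
apply/eqP; rewrite eq_le; apply/andP; split.
  apply: (@le_measure_thick _ m' a b c d 2) => //.
    by move=> *; rewrite m'E; exact: box_fin.
  by move=> n; rewrite mE m'E; exact: (flow0_box_le a b c d n).1.
apply: (@le_measure_thick _ m a b c d 2) => //.
by move=> n; rewrite mE m'E; exact: (flow0_box_le a b c d n).2.
Qed.

Lemma colour_flow0_eq s (A : set (mR * mR)) : measurable A ->
  mu (colour s `&` flow 0 @^-1` A) = mu (colour (~~ s) `&` flow 0 @^-1` A).
Proof.
have colour_fin r a b c d : (mu (colour r `&` flow 0 @^-1` box a b c d) < +oo)%E.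
  apply: le_lt_trans (flow0_box_fin a b c d).
  have mfb : measurable (flow 0 @^-1` box a b c d).
    by apply: preimage_measurable; [exact: measurable_flow|exact: measurable_box].
  have mI : measurable (colour r `&` flow 0 @^-1` box a b c d).
    by apply: measurableI => //; exact: measurable_colour.
  by apply: (le_measure mu); rewrite ?inE.
have le r a b c d : (mu (colour r `&` flow 0 @^-1` box a b c d) <=
    mu (colour (~~ r) `&` flow 0 @^-1` box a b c d))%E.
  have [m mE] := image_measure (measurable_colour (~~ r)); rewrite -mE.
  apply: (@le_measure_thick _ m a b c d 5) => //.
    by move=> *; rewrite mE; exact: colour_fin.
  by move=> n; rewrite mE; exact: colour_box_le.
have [m mE] := image_measure (measurable_colour s).
have [m' m'E] := image_measure (measurable_colour (~~ s)).
rewrite -mE -m'E; apply: measure_eq_boxes => a b c d; rewrite mE ?m'E//.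
apply/eqP; rewrite eq_le le /=.
by have := le (~~ s) a b c d; rewrite negbK.
Qed.

(** The images of the two colours are equal and add up to [leb2]. The factor one half appears as a
    doubled term, which avoids a division in the extended reals. *)
Lemma colour_measure s (A : set (mR * mR)) : measurable A ->
  (mu (colour s `&` flow 0 @^-1` A) + mu (colour s `&` flow 0 @^-1` A) = mu A)%E.
Proof.
move=> mA; have mfA : measurable (flow 0 @^-1` A).
  by apply: preimage_measurable; [exact: measurable_flow|].
rewrite {2}(colour_flow0_eq s mA) -(measureU mu).
- rewrite -setIUl -(flow0_measure mA); congr (mu _).
  apply/seteqP; split=> [x []//|x fx]; split=> //; rewrite /colour /=.
  by case: (chess 1 x); case: (s); rewrite /= ?eqxx; [left|right|right|left].
- by apply: measurableI => //; exact: measurable_colour.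
- by apply: measurableI => //; exact: measurable_colour.
- apply/seteqP; split=> x // [[/eqP xs _] [/eqP xs' _]].
  by move: xs'; rewrite xs; case: (s).
Qed.

End ColouredLimit.

(** * Test functions *)

Section TestFunctions.
Context {R : realType}.
Implicit Types (phi : R * (R * R) -> R) (v w z : R * (R * R)).

Lemma compact_bound (V : normedModType R) (A : set V) : compact A ->
  exists2 M : R, 0 < M & forall x, A x -> `|x| <= M.
Proof.
move=> /compact_bounded[M [_ HM]]; exists (`|M| + 1); first by rewrite ltr_wpDl.
by apply: HM; rewrite ltr_pwDr// ler_norm.
Qed.

Lemma continuous_bound (V : normedModType R) (f : V -> R) (A : set V) :
  continuous f -> compact A -> exists2 C : R, 0 < C & forall x, A x -> `|f x| <= C.
Proof.
move=> cf cA; have cfA : compact (f @` A).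
  by apply: continuous_compact => //; exact: continuous_subspaceT.
have [C C0 HC] := compact_bound cfA.
by exists C => // x Ax; apply: HC; exists x.
Qed.

Section OneTestFunction.
Variable phi : R * (R * R) -> R.
Hypothesis phi_test : test_function phi.

Lemma test_continuous : continuous phi.
Proof. by have [/(_ 0%N) h _] := phi_test. Qed.

Lemma test_differentiable z : differentiable phi z.
Proof. by have [/(_ 1%N) [h _] _] := phi_test; exact: h. Qed.

Lemma test_derive_continuous v : continuous ('D_v phi).
Proof. by have [/(_ 1%N) [_ h] _] := phi_test; exact: (h v). Qed.

Lemma test_support : exists2 M : R, 0 < M & forall z, M < `|z| -> phi z = 0.
Proof.
have [_ /compact_bound[M M0 HM]] := phi_test; exists M => // z Mz.
apply/eqP/negPn/negP => /eqP pz.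
have /HM : closure [set z | phi z != 0] z by apply: subset_closure; apply/eqP.
by rewrite leNgt Mz.
Qed.

Lemma test_bound : exists2 C : R, 0 < C & forall z, `|phi z| <= C.
Proof.
have [_ cK] := phi_test; have [C C0 HC] := continuous_bound test_continuous cK.
exists C => // z; have [->|pz] := eqVneq (phi z) 0; first by rewrite normr0 ltW.
by apply: HC; exact: subset_closure.
Qed.

Lemma test_derive_bound v : exists2 C : R, 0 < C & forall z, `|'D_v phi z| <= C.
Proof.
have [_ cK] := phi_test; have [C C0 HC] := continuous_bound (@test_derive_continuous v) cK.
exists C => // z; have [Kz|Kz] := pselect (closure [set z | phi z != 0] z); first exact: HC.
rewrite (_ : 'D_v phi z = 0) ?normr0 ?ltW//.
have nz : \forall x \near z, phi x = 0.
  have : open (~` closure [set z | phi z != 0]) by apply: closed_openC; exact: closed_closure.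
  rewrite openE => /(_ z Kz); apply: filterS => x Kx.
  apply/eqP/negPn/negP => pz; apply: Kx; exact: subset_closure.
have -> : 'D_v phi z = 'D_v (cst 0) z by apply: near_eq_derive => //.
exact: derive_cst.
Qed.

Lemma derive_line z w (s : R) :
  is_derive s 1 (fun u => phi (z + u *: w)) ('D_w phi (z + s *: w)).
Proof.
have E : (fun h : R => h^-1 *: (((fun u : R => phi (z + u *: w)) \o shift s) (h *: 1) -
      phi (z + s *: w))) =
    (fun h : R => h^-1 *: ((phi \o shift (z + s *: w)) (h *: w) - phi (z + s *: w))).
  apply/funext => h /=; congr (_ *: (phi _ - _)).
  by rewrite /GRing.scale /= mulr1 [RHS]addrC -addrA -scalerDl [h + s]addrC.
have D : derivable phi (z + s *: w) w.
  by apply: diff_derivable; exact: test_differentiable.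
by split; rewrite /derivable /derive E.
Qed.

(** The mean value theorem on the segment from z to z + w, the derivative along w being a
    combination of three bounded partial derivatives. *)
Lemma test_lipschitz : exists2 L : R, 0 < L & forall z w, `|phi (z + w) - phi z| <= L * `|w|.
Proof.
have [C1 C10 H1] := test_derive_bound (1, (0, 0)).
have [C2 C20 H2] := test_derive_bound (0, (1, 0)).
have [C3 C30 H3] := test_derive_bound (0, (0, 1)).
exists (C1 + C2 + C3); first by rewrite !addr_gt0.
move=> z w.
have Db y : `|'D_w phi y| <= (C1 + C2 + C3) * `|w|.
  have dy := test_differentiable y.
  have wE : w = w.1 *: (1, (0, 0)) + w.2.1 *: (0, (1, 0)) + w.2.2 *: (0, (0, 1)).
    rewrite [LHS]surjective_pairing [RHS]surjective_pairing; congr pair.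
      by rewrite /= /GRing.scale /=; ring.
    by apply: pair_eq; rewrite /= /GRing.scale /=; ring.
  rewrite deriveE// {1}wE !linearD !linearZ /= -!deriveE//.
  have [n1 n2 n3] : [/\ `|w.1| <= `|w|, `|w.2.1| <= `|w| & `|w.2.2| <= `|w|].
    have h : `|w.2| <= `|w| by rewrite [leRHS]prod_normE le_max lexx orbT.
    split; first by rewrite [leRHS]prod_normE le_max lexx.
      by apply: le_trans h; exact: norm_fst.
    by apply: le_trans h; exact: norm_snd.
  rewrite !mulrDl; apply: le_trans (ler_normD _ _) _; apply: lerD.
    apply: le_trans (ler_normD _ _) _; apply: lerD; rewrite normrM mulrC;
      by apply: ler_pM.
  by rewrite normrM mulrC; apply: ler_pM.
have [|c _] := @MVT _ (fun u => phi (z + u *: w)) (fun u => 'D_w phi (z + u *: w)) 0 1 ltr01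
   (fun s _ => derive_line z w s).
  apply: derivable_within_continuous => s _; exact: (derive_line z w s).(ex_derive).
by rewrite scale1r scale0r addr0 subr0 mulr1 => ->.
Qed.

Lemma test_increment_cvg z w :
  (n.+1%:R * (phi (z + n.+1%:R^-1 *: w) - phi z)) @[n --> \oo] --> 'D_w phi z.
Proof.
have D : derivable phi z w by apply: diff_derivable; exact: test_differentiable.
have /(_ (fun n => n.+1%:R^-1)) H := (cvgr_dnbhsP _ _ _).1 D.
have {H} : (fun n => n.+1%:R^-1^-1 *: ((phi \o shift z) (n.+1%:R^-1 *: w) - phi z)) n
    @[n --> \oo] --> 'D_w phi z.
  apply: H; split; last exact: cvg_harmonic.
  by move=> n; rewrite invr_eq0 pnatr_eq0.
by under eq_fun do rewrite invrK /= [_ *: w + z]addrC.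
Qed.

End OneTestFunction.
End TestFunctions.

(** * Integrating the right derivative of a Lipschitz function *)

Section BoundedSupport.
Context {d} {T : measurableType d} {R : realType} (mu : {measure set T -> \bar R}).
Implicit Types (A : set T) (f : T -> R) (c : R).

Lemma integrable_indic_fin A : measurable A -> (mu A < +oo)%E ->
  mu.-integrable setT (EFin \o \1_A).
Proof.
move=> mA fA; apply/integrableP; split.
  by apply/measurable_EFinP; exact: measurable_indic.
under eq_integral => x _ do rewrite /= ger0_norm //.
by rewrite integral_indic// setIT.
Qed.

Lemma integrable_scaled_indic A c : measurable A -> (mu A < +oo)%E ->
  mu.-integrable setT (fun x => (c * \1_A x)%:E).
Proof.
move=> mA fA; under eq_fun do rewrite EFinM.
by apply: integrableZl => //; exact: integrable_indic_fin.
Qed.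

Lemma integrable_supported A f c : measurable A -> (mu A < +oo)%E ->
  measurable_fun setT f -> (forall x, `|f x| <= c * \1_A x) ->
  mu.-integrable setT (EFin \o f).
Proof.
move=> mA fA mf fc; apply: (le_integrable measurableT _ _ (integrable_scaled_indic c mA fA)).
  exact/measurable_EFinP.
by move=> x _ /=; rewrite lee_fin; apply: le_trans (fc x) (ler_norm _).
Qed.

Lemma le_norm_Rintegral_supported A f c : measurable A -> (mu A < +oo)%E ->
  measurable_fun setT f -> (forall x, `|f x| <= c * \1_A x) ->
  `|\int[mu]_x f x| <= c * fine (mu A).
Proof.
move=> mA fA mf fc; have ig := integrable_scaled_indic c mA fA.
have If := integrable_supported mA fA mf fc.
rewrite -lee_fin -abse_EFin /Rintegral fineK; last exact: integrable_fin_num.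
apply: le_trans (le_abse_integral _ _ _) _ => //; first exact/measurable_EFinP.
have -> : ((c * fine (mu A))%:E = \int[mu]_x (c * \1_A x)%:E)%E.
  under eq_integral do rewrite EFinM.
  rewrite integralZl//; last exact: integrable_indic_fin.
  by rewrite integral_indic// setIT EFinM fineK// ge0_fin_numE.
apply: le_integral => //; first exact: integrable_abse.
by move=> x _; rewrite lee_fin.
Qed.

End BoundedSupport.

Section RightDerivative.
Context {R : realType}.
Local Notation leb := (@lebesgue_measure R).
Local Notation mR := (measurableTypeR R).

Lemma measurable_fun_countable disp (T : measurableType disp) (f : mR -> T) (A : set mR) :
  countable A -> measurable_fun A f.
Proof.
move=> cA _ B mB; apply: countable_measurable; first by move=> t; exact: measurable_set1.
exact: sub_countable (subset_card_le (@subIsetl _ _ _)) cA.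
Qed.

Lemma lipschitz_continuous (F : R -> R) (L : R) : 0 < L ->
  (forall s t, `|F t - F s| <= L * `|t - s|) -> continuous F.
Proof.
move=> L0 FL t; apply/cvgrPdist_le => e e0; near=> s.
apply: le_trans (FL s t) _; rewrite mulrC -ler_pdivlMr//.
near: s; apply: (@cvgr_dist_le _ _ _ _ _ id t) => //.
by rewrite divr_gt0.
Unshelve. all: by end_near. Qed.

Lemma lebesgue_segment_fin (u v : R) : (leb (`[u, v]%classic : set R) < +oo)%E.
Proof. by rewrite lebesgue_measure_itv /=; case: ifP; rewrite ?ltry// -EFinB ltry. Qed.

Variables (F : R -> R) (L M : R).
Hypotheses (L0 : 0 < L) (M0 : 0 < M).
Hypothesis FL : forall s t, `|F t - F s| <= L * `|t - s|.
Hypothesis FM : forall t, M <= t -> F t = 0.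

Let mF : measurable_fun setT (F : mR -> mR).
Proof. by apply: continuous_measurable_fun; exact: lipschitz_continuous FL. Qed.

Let F_bound t : 0 <= t -> `|F t| <= L * M * \1_`[0, M] t.
Proof.
move=> t0; rewrite indicE; have [tM|Mt] := leP t M.
  rewrite mem_set ?mulr1 /=; last by rewrite in_itv /= t0.
  have := FL M t; rewrite (FM (lexx M)) subr0 => /le_trans; apply.
  by rewrite ler_pM2l// ler_norml; apply/andP; split; lra.
by rewrite (FM (ltW Mt)) normr0 mulr_ge0// mulr_ge0// ltW.
Qed.

Let IF (b : R) : 0 <= b -> leb.-integrable `[b, +oo[ (EFin \o F).
Proof.
move=> b0; apply: (@le_integrable _ _ _ _ _ _ _
    (fun t : mR => (L * M * \1_(`[0, M]%classic : set mR) t)%:E)) => //.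
- by apply/measurable_EFinP; exact: measurable_funTS.
- move=> t; rewrite /= in_itv /= andbT => bt; rewrite lee_fin.
  by apply: le_trans (F_bound (le_trans b0 bt)) (ler_norm _).
apply: (integrableS measurableT) => //; apply: integrable_scaled_indic => //.
exact: lebesgue_segment_fin.
Qed.

Let shift_integral (c : R) : 0 <= c ->
  leb.-integrable `[0, +oo[ (fun t => (F (t + c))%:E) /\
  (\int[leb]_(t in `[0%R, +oo[) (F (t + c))%:E = \int[leb]_(t in `[c, +oo[) (F t)%:E)%E.
Proof.
move=> c0; have mc := @measurable_addr R c.
have D : (fun t : mR => (t + c : mR)) @^-1` `[c, +oo[ = `[0, +oo[%classic.
  by apply/seteqP; split=> t /=; rewrite !in_itv /= !andbT lerDr.
have Ic : leb.-integrable `[0, +oo[ (fun t => (F (t + c))%:E).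
  apply: (@le_integrable _ _ _ _ _ _ _
    (fun t : mR => (L * M * \1_(`[0, M]%classic : set mR) t)%:E)) => //.
  - apply/measurable_EFinP; apply: measurable_funTS.
    exact: (measurableT_comp mF mc).
  - move=> t; rewrite /= in_itv /= andbT => t0; rewrite lee_fin.
    apply: le_trans (ler_norm _); apply: le_trans (F_bound (addr_ge0 t0 c0)) _.
    rewrite ler_pM2l ?mulr_gt0// !indicE; have [|_] := boolP (t + c \in _).
      rewrite inE /= in_itv /= => /andP[_ h].
      by rewrite mem_set //= in_itv /= t0; lra.
    by rewrite ler0n.
  apply: (integrableS measurableT) => //; apply: integrable_scaled_indic => //.
  exact: lebesgue_segment_fin.
split=> //; rewrite -D in Ic *.
have mF' : measurable_fun setT (fun t : mR => (F t)%:E) by exact/measurable_EFinP.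
rewrite -[LHS](@integral_pushforward _ _ mR mR R _ mc leb _ _ mF' Ic)//.
by apply: eq_measure_integral => A mA _; exact: lebesgue_translation.
Qed.

Definition increment (n : nat) (t : R) : R := n.+1%:R * (F (t + n.+1%:R^-1) - F t).

Let start_integral (c : R) : 0 < c ->
  exists2 I : R, `|I - c * F 0| <= L * c * c &
    (\int[leb]_(t in `[0%R, +oo[) (F t)%:E = I%:E + \int[leb]_(t in `[c, +oo[) (F t)%:E)%E.
Proof.
move=> c0; pose S : set mR := `[0, c[%classic.
have mS : measurable S by exact: measurable_itv.
have U : `[0, +oo[%classic = S `|` `[c, +oo[.
  apply/seteqP; split=> t; rewrite /S /= !in_itv /= !andbT.
    by move=> t0; case: (ltP t c) => tc; [left; rewrite t0|right].
  by move=> [/andP[]//|]; apply: le_trans (ltW c0).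
have IS : leb.-integrable S (EFin \o F).
  by apply: integrableS (IF (lexx 0)) => //; rewrite U; exact: subsetUl.
have mSE : leb S = c%:E.
  by rewrite lebesgue_measure_itv /= lte_fin c0 -EFinB subr0.
exists (fine (\int[leb]_(t in S) (F t)%:E)); last first.
  rewrite fineK; last exact: integrable_fin_num.
  rewrite U integral_setU//.
  - exact/measurable_EFinP/measurable_funTS.
  - apply/disj_setPS => t; rewrite /S /= !in_itv /= andbT => -[]; move=> /andP[_ h1] h2.
    by move: (lt_le_trans h1 h2); rewrite ltxx.
have cst_int (k : R) : leb.-integrable S (cst k%:E).
  by apply/integrableP; split => //; rewrite integral_cst//= mSE -EFinM ltry.
have dist t : t \in S -> `|F t - F 0| <= L * c.
  rewrite inE /S /= in_itv /= => /andP[t0 tc]; apply: le_trans (FL 0 t) _.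
  by rewrite subr0 ger0_norm// ler_pM2l// ltW.
have up : (\int[leb]_(t in S) (F t)%:E <= ((F 0 + L * c) * c)%:E)%E.
  rewrite EFinM -mSE -(integral_cst leb mS); apply: le_integral => //.
  by move=> t /dist; rewrite lee_fin ler_norml => /andP[? ?]; lra.
have lo : (((F 0 - L * c) * c)%:E <= \int[leb]_(t in S) (F t)%:E)%E.
  rewrite EFinM -mSE -(integral_cst leb mS); apply: le_integral => //.
  by move=> t /dist; rewrite lee_fin ler_norml => /andP[? ?]; lra.
move: up lo; rewrite -(@fineK _ (\int[leb]_(t in S) (F t)%:E)%E); last exact: integrable_fin_num.
rewrite !lee_fin /=; move: (fine _) => I; rewrite ler_norml => ? ?.
by apply/andP; split; lra.
Qed.

(** With c = 1 / (n + 1), the two integrals cancel except on [0, c[, which leaves minus the mean of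
    [F] there, and this mean is [F 0] up to L c. *)
Let integral_increment n : exists2 I : R, `|I - F 0| <= L * n.+1%:R^-1 &
  (\int[leb]_(t in `[0%R, +oo[) (increment n t)%:E = (- I)%:E)%E.
Proof.
set c : R := n.+1%:R^-1; have c0 : 0 < c by rewrite invr_gt0.
have [I Ic IE] := start_integral c0.
have [Is sE] := shift_integral (ltW c0).
have nc : n.+1%:R = c^-1 by rewrite invrK.
exists (c^-1 * I).
  rewrite -(ler_pM2l c0); apply: le_trans (_ : _ <= L * c * c) _; last by rewrite mulrC.
  rewrite -[X in X * `|_|](gtr0_norm c0) -normrM mulrBr mulrA divff ?gt_eqF// mul1r//.
have fin (b : R) : 0 <= b -> (\int[leb]_(t in `[b, +oo[) (F t)%:E)%E \is a fin_num.
  by move=> b0; apply: integrable_fin_num => //; exact: IF.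
transitivity (\int[leb]_(t in `[0%R, +oo[) ((c^-1)%:E * ((F (t + c)%R)%:E - (F t)%:E)))%E.
  by apply: eq_integral => t _; rewrite /increment -/c nc EFinM EFinB.
have I0 : leb.-integrable `[0, +oo[ (fun t => (F t)%:E) := IF (lexx 0).
have mD : measurable (`[0, +oo[%classic : set mR) by exact: measurable_itv.
rewrite (integralZl mD (integrableB mD Is I0)).
rewrite (integralB mD Is I0).
rewrite sE IE -(fineK (fin c (ltW c0))) -!EFinD -EFinM; congr EFin; ring.
Qed.

(* Dominated convergence applied to the difference quotients of F. *)
Lemma integral_right_derivative (G : R -> \bar R) (C : set R) : countable C ->
  (forall t, 0 <= t -> ~ C t -> (increment n t)%:E @[n --> \oo] --> G t) ->
  (\int[leb]_(t in `[0%R, +oo[) G t = (- F 0)%:E)%E.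
Proof.
move=> cC FG; pose D : set mR := `[0, +oo[%classic.
have mD : measurable D by exact: measurable_itv.
have mC : measurable (C : set mR).
  by apply: countable_measurable => // t; exact: measurable_set1.
have minc n : measurable_fun setT (fun t : mR => (increment n t)%:E).
  apply/measurable_EFinP; apply: measurable_funM => //; apply: measurable_funB => //.
  exact: (measurableT_comp mF (measurable_addr _)).
(* Off [C] the function is a limit of measurable ones; on the countable set [C] every function is
   measurable. *)
have mG : measurable_fun D (G : mR -> \bar R).
  rewrite (_ : D = (D `\` C) `|` (D `&` C)); last by rewrite setUC setUIDK.
  apply/measurable_funU; [exact: measurableD|exact: measurableI|split].
    apply: (@emeasurable_fun_cvg _ _ _ _ (fun n t => (increment n t)%:E)) => [n|t [tD tC]].
      exact: (measurable_funTS (minc n)).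
    by apply: FG => //; move: tD; rewrite /D /= in_itv /= andbT.
  apply: measurable_fun_countable; exact: sub_countable (subset_card_le (@subIsetr _ _ _)) cC.
have nullC : leb.-negligible C.
  by apply/negligibleP => //; exact: countable_lebesgue_measure0.
have [] := @dominated_convergence _ _ _ leb D mD (fun n t => (increment n t)%:E) G
  (fun t => (L * \1_(`[0, M]%classic : set mR) t)%:E).
- by move=> n; exact: (measurable_funTS (minc n)).
- exact: mG.
- exists C; split=> // [|t /=]; first exact: countable_lebesgue_measure0.
  by apply: contra_notP => tC tD; apply: FG => //; move: tD; rewrite /D /= in_itv /= andbT.
- apply: (integrableS measurableT) => //; apply: integrable_scaled_indic => //.
  exact: lebesgue_segment_fin.
- apply: aeW => t n; rewrite /D /= in_itv /= andbT => t0; rewrite lee_fin.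
  have n0 : (0 : R) < n.+1%:R by [].
  rewrite indicE; have [tM|Mt] := leP t M.
    rewrite mem_set ?mulr1 /=; last by rewrite in_itv /= t0.
    rewrite /increment normrM (gtr0_norm n0) mulrC -ler_pdivlMr//.
    by apply: le_trans (FL _ _) _; rewrite addrAC subrr add0r ger0_norm// invr_ge0.
  rewrite /increment !FM ?(ltW Mt)// ?subrr ?mulr0 ?normr0 ?mulr_ge0 ?(ltW L0)//.
  by rewrite (le_trans (ltW Mt))// lerDl invr_ge0.
move=> _ _ lim; have {}lim := cvg_lim (@ereal_hausdorff R) lim; rewrite -lim.
apply: cvg_lim => //; apply/fine_cvgP; split.
  by apply: nearW => n; have [I _ IE] := integral_increment n; rewrite [X in X \is a _]IE.
apply/cvgrPdist_le => e e0; near=> n => /=.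
have [I In IE] := integral_increment n.
rewrite [X in fine X]IE /= opprK addrC; apply: le_trans In _.
rewrite mulrC -ler_pdivlMr//; near: n.
have := @cvg_harmonic R; move/cvgrPdist_le => /(_ (e / L)); rewrite divr_gt0// => /(_ isT).
by apply: filterS => n; rewrite sub0r normrN ger0_norm ?harmonic_ge0.
Unshelve. all: by end_near. Qed.

End RightDerivative.

(** * Transported functions are weak solutions *)

Section FieldAtTime.
Context {R : realType}.
Local Notation mR := (measurableTypeR R).
Local Notation mu := (@leb2 R).

Lemma cell_center_dist (d : R) (x : R * R) : 0 < d -> `|cell_center d x - x| <= d.
Proof.
move=> d0; have aux (u : R) : `|d * (Num.floor (u / d + 1 / 2))%:~R - u| <= d.
  have uE : u = d * (u / d) by rewrite mulrC divfK// gt_eqF.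
  have /andP[z1 z2] := floor_itv (u / d + 1 / 2); rewrite intrD in z2.
  rewrite {2}uE -mulrBr normrM (gtr0_norm d0) -[leRHS]mulr1 ler_pM2l//.
  by rewrite ler_norml; apply/andP; split; lra.
by rewrite norm_pair_le; apply/andP; split; exact: aux.
Qed.

(** A continuous function is the limit of its values at the nearest points of the lattices of step
    2^-n, and these depend only on the cell index. *)
Lemma measurable_continuous_plane (f : R * R -> R) : continuous f ->
  measurable_fun setT (f : mR * mR -> mR).
Proof.
move=> cf; apply: (@measurable_fun_cvg _ _ _ setT
  (fun n x => f (cell_center (2 ^- n) x))) => [n|x _].
  exact: (measurable_comp_fibers (fun y => f (lattice_point (2 ^- n) y))
    (@measurable_fibers_cell_index R (2 ^- n))).
have cx : cell_center (2 ^- n) x @[n --> \oo] --> (x : R * R); last first.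
  exact: (cvg_comp _ _ cx (cf x)).
apply/cvgrPdist_lt => e e0.
have := @cvg_half_pow R; move/cvgrPdist_lt => /(_ e e0); apply: filterS => n.
rewrite sub0r normrN ger0_norm ?ltW ?half_pow_gt0// => ne.
by rewrite distrC; apply: le_lt_trans ne; exact: cell_center_dist (half_pow_gt0 _ _).
Qed.

Lemma measurable_wrot disp (T : measurableType disp) (p : T -> mR * mR) :
  measurable_fun setT p -> measurable_fun setT (fun x => wrot (p x) : mR * mR).
Proof.
move=> mp; have m1 := measurable_coord1 mp; have m2 := measurable_coord2 mp.
have mn (r : T -> mR) : measurable_fun setT r -> measurable_fun setT (fun x => `|r x : R| : mR).
  by move=> mr; exact: measurableT_comp.
apply: measurable_fun_ifT.
- by apply: measurable_fun_ltr; exact: mn.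
- by apply: measurable_pairing => //; exact: measurable_funM.
apply: measurable_fun_ifT => //.
- by apply: measurable_fun_ltr; exact: mn.
- by apply: measurable_pairing => //; exact: measurable_funM.
Qed.

Lemma measurable_depauw_u (d : R) : 0 < d ->
  measurable_fun setT (fun x : mR * mR => depauw_u (d^-1 *: (x : R * R)) : mR * mR).
Proof.
move=> d0; rewrite (_ : (fun _ => _) = fun x : mR * mR =>
    if in_cell d x then d^-1 *: wrot (x - cell_center d x) else 0 : mR * mR); last first.
  by apply/funext => x; rewrite depauw_uE.
apply: measurable_fun_ifT => //; first exact: measurable_in_cell.
have mw : measurable_fun setT (fun x : mR * mR => wrot (x - cell_center d x) : mR * mR).
  apply: measurable_wrot; apply: measurable_addP => //; apply: measurable_oppP.
  exact: measurable_cell_center.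
by apply: measurable_pairing; apply: measurable_funM => //;
  [exact: measurable_coord1|exact: measurable_coord2].
Qed.

(** Before time 1 the exceptional particles are those on a diagonal at time t, a null set because
    [flow t] preserves measure; after time 1 there are none. *)
Lemma regular_time (t : R) : 0 < t -> (forall k, t != 2 ^- k) ->
  measurable_fun setT (fun x : mR * mR => depauw_b (t, x : R * R) : mR * mR) /\
  exists N : set (mR * mR), [/\ measurable N, mu N = 0%E &
    forall z, ~ N z -> exists2 e, 0 < e & forall h, `|h| <= e ->
      flow (t + h) z = flow t z + h *: depauw_b (t, flow t z)].
Proof.
move=> t0 tk; have [t1|t1|t1] := ltgtP t 1; last first.
- by have := tk 0%N; rewrite expr0 invr1 t1 eqxx.
- split.
    by rewrite (_ : (fun _ => _) = cst 0)//; apply/funext => x; exact: depauw_b_gt1.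
  by exists set0; split => // z _; exact: flow_field_gt1.
have [||k tk'] := @slab_exists _ t; [by rewrite t0|by []|].
split.
  rewrite (_ : (fun _ => _) = fun x : mR * mR => depauw_u ((2 ^- k)^-1 *: (x : R * R))).
    exact: measurable_depauw_u (half_pow_gt0 _ _).
  by apply/funext => x; rewrite (depauw_b_slab _ tk') invrK.
pose D : set (mR * mR) := [set x | on_diagonal (2 ^- k) x].
have mD : measurable D.
  by apply: measurable_bool; apply: measurable_on_diagonal; exact: half_pow_gt0.
have [mf f1] := mp_flow t0.
exists (flow t @^-1` D); split.
- exact: preimage_measurable.
- exact: (etrans (f1 D mD) (on_diagonal_null (half_pow_gt0 R k))).
- by move=> z /negP; exact: flow_field.
Qed.

End FieldAtTime.

(** * Functions carried by the flow *)

Section Transport.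
Context {R : realType}.
Local Notation mR := (measurableTypeR R).
Local Notation mu := (@leb2 R).
Implicit Types (t : R) (x z : R * R) (n m : nat).

Lemma flow_upto_inv_stable n m t x : 2 ^- n <= t -> (n <= m)%N ->
  flow_upto_inv m t x = flow_upto_inv n t x.
Proof.
move=> nt /subnK <-; elim: (m - n)%N => // j IH; rewrite addSn /= clip_ge ?oppr0 ?cell_rot0//.
exact: le_trans (half_pow_le (leq_addl _ _)) nt.
Qed.

Variables (f : mR * mR -> mR) (B : R).
Hypotheses (mf : measurable_fun setT f) (fB : forall x, `|f x : R| <= B).

(** At each point this sequence is eventually constant, so its limit is jointly measurable in time
    and space. *)
Let transport_upto n (p : mR * (mR * mR)) : mR :=
  if 2 ^- n <= (p.1 : R) then f (flow_upto_inv n p.1 p.2) else 0.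

(* The function carried by the flow whose value at time 1 is f; it vanishes for
   t <= 0. *)
Definition transport (p : R * (R * R)) : R := limn (transport_upto ^~ p).

Lemma transportE n t x : 2 ^- n <= t -> transport (t, x) = f (flow_upto_inv n t x).
Proof.
move=> nt; apply: cvg_lim => //; apply: cvg_near_cst; exists n => // m /= nm.
rewrite /transport_upto /= (le_trans (half_pow_le nm) nt).
by rewrite (flow_upto_inv_stable _ nt nm).
Qed.

Lemma transport_le0 t x : t <= 0 -> transport (t, x) = 0.
Proof.
move=> t0; apply: cvg_lim => //; apply: cvg_near_cst; apply: nearW => n.
by rewrite /transport_upto /= leNgt (le_lt_trans t0 (half_pow_gt0 R n)).
Qed.

Lemma transport_flow t z : 0 < t -> transport (t, flow t z) = f z.
Proof.
move=> /half_pow_lt_pos[n nt].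
by rewrite (transportE _ nt) (flowE _ nt) flow_upto_invK.
Qed.

Lemma transport_ge1 t x : 1 <= t -> transport (t, x) = f x.
Proof. by move=> t1; rewrite (@transportE 0)// expr0 invr1. Qed.

Lemma transport_value p : transport p = 0 \/ exists z, transport p = f z.
Proof.
case: p => t x; have [t0|/half_pow_lt_pos[n nt]] := leP t 0.
  by left; exact: transport_le0.
by right; exists (flow_upto_inv n t x); exact: transportE.
Qed.

Lemma transport_bound p : `|transport p| <= B.
Proof.
have B0 : 0 <= B := le_trans (normr_ge0 _) (fB 0).
by have [->|[z ->]] := transport_value p; rewrite ?normr0.
Qed.

Lemma measurable_transport : measurable_fun setT (transport : mR * (mR * mR) -> mR).
Proof.
apply: (@measurable_fun_cvg _ _ _ setT transport_upto) => [n|[t x] _].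
  apply: measurable_fun_ifT => //.
    by apply: measurable_fun_ler => //; exact: measurable_fst.
  apply: (measurableT_comp mf); apply: measurable_flow_upto_inv.
    exact: measurable_fst.
  exact: measurable_snd.
have [t0|/half_pow_lt_pos[k kt]] := leP t 0.
  rewrite transport_le0//; apply: cvg_near_cst; apply: nearW => n.
  by rewrite /transport_upto /= leNgt (le_lt_trans t0 (half_pow_gt0 R n)).
rewrite (transportE _ kt); apply: cvg_near_cst; exists k => // m /= km.
rewrite /transport_upto /= (le_trans (half_pow_le km) kt).
by rewrite (flow_upto_inv_stable _ kt km).
Qed.

Lemma transport_Linfty_loc : Linfty_loc transport.
Proof.
move=> T T0; set D := `[0, T] `*` setT.
have mD : measurable (D : set (mR * (mR * mR))) by apply: measurableX => //; exact: measurable_itv.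
have mrho : measurable_fun setT (transport \_ D : mR * (mR * mR) -> mR).
  apply: (measurable_restrictT _ mD).1; apply: (measurable_funS measurableT) => //.
  exact: measurable_transport.
apply/andP; split; rewrite inE //=.
rewrite /finite_norm unlock /=; case: ifP => // _.
apply: (@le_lt_trans _ _ B%:E); last exact: ltry.
apply/ess_supP; apply: aeW => p /=; rewrite lee_fin /patch.
by case: ifP => _; rewrite ?transport_bound// normr0 (le_trans (normr_ge0 _) (fB 0)).
Qed.

End Transport.

(** * The weak formulation along trajectories *)

Section WeakFormulation.
Context {R : realType}.
Local Notation mR := (measurableTypeR R).
Local Notation mu := (@leb2 R).
Local Notation leb := (@lebesgue_measure R).
Variables (f : mR * mR -> mR) (B : R) (phi : R * (R * R) -> R).
Hypotheses (mf : measurable_fun setT f) (B0 : 0 < B) (fB : forall x, `|f x : R| <= B).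
Hypothesis phi_test : test_function phi.

Let integrand t (z : mR * mR) : mR := f z * phi (t, flow t z).

Definition mean t : R := \int[mu]_z integrand t z.

Lemma continuous_slice (g : R * (R * R) -> R) t : continuous g -> continuous (fun x => g (t, x)).
Proof.
move=> cg x; have tx : (t, y) @[y --> x] --> (t, x).
  apply/cvgrPdist_lt => e e0; near=> y.
  have -> : `|(t, x) - (t, y)| = `|x - y|.
    by rewrite prod_normE /= subrr normr0; apply/max_idPr.
  by near: y; exact: cvgr_dist_lt.
exact: (cvg_comp _ _ tx (cg (t, x))).
Unshelve. all: by end_near. Qed.

Lemma measurable_slice_flow (g : R * (R * R) -> R) t : continuous g ->
  measurable_fun setT (fun z : mR * mR => g (t, flow t z) : mR).
Proof.
move=> cg; have mg := measurable_continuous_plane (continuous_slice (t := t) cg).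
exact: (measurableT_comp mg (measurable_flow t)).
Qed.

Lemma measurable_integrand t : measurable_fun setT (integrand t).
Proof.
by apply: measurable_funM => //; apply: measurable_slice_flow; exact: test_continuous phi_test.
Qed.

Lemma norm_time_space (t : R) (x : R * R) : `|(t, x)| = Num.max `|t| `|x|.
Proof. by []. Qed.

(* All integrands are supported in a common box, since particles move by at
   most 2. *)
Lemma common_support : exists M L : R, [/\ 0 < M, 0 < L,
  forall t, M <= t -> forall z, integrand t z = 0,
  forall t z, `|integrand t z| <= L * \1_(box (- M) M (- M) M) z &
  forall s t z, `|integrand t z - integrand s z| <=
    L * `|t - s| * \1_(box (- M) M (- M) M) z].
Proof.
have [S S0 HS] := test_support phi_test; have [K K0 HK] := test_lipschitz phi_test.
have [C C0 HC] := test_bound phi_test.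
(* [M] is the radius of the support of [phi] plus the displacement 2 and a margin 1. [L] serves both
   bounds: [B * (K * 2)] the Lipschitz one, with 2 the speed of the particles, and [B * C] the
   size. *)
pose L := B * (K * 2) + B * C; pose M := S + 3.
have M0 : 0 < M by rewrite addr_gt0.
have L0 : 0 < L by rewrite addr_gt0// !mulr_gt0.
have late t : M <= t -> forall z, integrand t z = 0.
  move=> Mt z; rewrite /integrand HS ?mulr0// norm_time_space lt_max; apply/orP; left.
  by have := ler_norm t; move: Mt; rewrite /M; lra.
have away t z : M < `|z| -> integrand t z = 0.
  move=> Mz; rewrite /integrand HS ?mulr0// norm_time_space lt_max; apply/orP; right.
  have := flow_near_start t z; have := ler_distD (flow t z) z 0.
  by rewrite !subr0 (distrC z); move: Mz; rewrite /M; lra.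
have outside z : ~~ (z \in box (- M) M (- M) M) -> M < `|z|.
  rewrite notin_setE => nz; rewrite ltNge; apply/negP; rewrite norm_pair_le !ler_norml.
  by move=> /andP[z1 z2]; apply: nz.
have lip s t z : `|integrand t z - integrand s z| <= L * `|t - s| * \1_(box (- M) M (- M) M) z.
  rewrite indicE; have [_|/outside Mz] := boolP (z \in _); last first.
    by rewrite !away// subrr normr0 mulr0.
  rewrite mulr1 /integrand -mulrBr normrM.
  apply: (@le_trans _ _ (B * (K * 2) * `|t - s|)); last first.
    by rewrite ler_wpM2r// lerDl ltW// mulr_gt0.
  rewrite -!mulrA; apply: ler_pM => //.
  have -> : (t, flow t z) = (s, flow s z) + (t - s, flow t z - flow s z).
    by congr pair; rewrite /= addrC subrK.
  apply: le_trans (HK _ _) _; rewrite ler_pM2l// norm_time_space ge_max.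
  rewrite flow_lipschitz andbT; have := normr_ge0 (t - s); lra.
exists M, L; split=> // t z.
rewrite indicE; have [_|/outside Mz] := boolP (z \in _); last first.
  by rewrite away// normr0 mulr0.
rewrite mulr1 /integrand normrM; apply: (@le_trans _ _ (B * C)); first exact: ler_pM.
by rewrite lerDr ltW// !mulr_gt0.
Qed.

Let box_fin_lt M : (mu (box (- M) M (- M) M) < +oo)%E.
Proof. exact: box_fin. Qed.

Lemma mean_difference s t : mean t - mean s = \int[mu]_z (integrand t z - integrand s z).
Proof.
have [M [L [_ _ _ b _]]] := common_support.
have I u : mu.-integrable setT (EFin \o integrand u).
  exact: (integrable_supported (@measurable_box R _ _ _ _) (box_fin_lt M)
    (measurable_integrand u) (b u)).
by rewrite /mean RintegralB.
Qed.

Definition field_derivative t (x : R * R) : R :=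
  dt phi (t, x) + dot2 (depauw_b (t, x)) (grad_x phi (t, x)).

(** Linearity of the differential: what the equation tests is the derivative of [phi] along the
    trajectory. *)
Lemma field_derivativeE t x : field_derivative t x = 'D_(1, depauw_b (t, x)) phi (t, x).
Proof.
have D := test_differentiable phi_test (t, x).
rewrite /field_derivative /dt /dot2 /grad_x /=; move: (depauw_b (t, x)) => [b1 b2] /=.
have -> : (1, (b1, b2)) = (1, (0, 0)) + (b1 *: (0, (1, 0)) + b2 *: (0, (0, 1))) :> R * (R * R).
  rewrite [RHS]surjective_pairing; congr pair; first by rewrite /= /GRing.scale /=; ring.
  by apply: pair_eq; rewrite /= /GRing.scale /=; ring.
by rewrite !deriveE// !linearD !linearZ.
Qed.

Lemma measurable_field_derivative_flow t :
  measurable_fun setT (fun x : mR * mR => depauw_b (t, x : R * R) : mR * mR) ->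
  measurable_fun setT (field_derivative t : mR * mR -> mR).
Proof.
move=> mb; have m v : measurable_fun setT (fun x : mR * mR => 'D_v phi (t, x : R * R) : mR).
  apply: measurable_continuous_plane; apply: (@continuous_slice ('D_v phi)).
  exact: test_derive_continuous phi_test _.
apply: measurable_funD; first exact: m.
apply: measurable_funD; apply: measurable_funM; do ?exact: m.
  exact: measurable_coord1.
exact: measurable_coord2.
Qed.

(** For almost every z the trajectory is affine near t, so for large n the increment of [phi] along
    it is an increment along a straight line; the common Lipschitz bound on a box dominates. *)
Lemma increment_mean_cvg (t : R) : 0 < t -> (forall k, t != 2 ^- k) ->
  mu.-integrable setT (fun z => (f z * field_derivative t (flow t z))%:E) /\
  ((increment mean n t)%:E @[n --> \oo] -->
    (\int[mu]_z (f z * field_derivative t (flow t z))%:E)%E).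
Proof.
move=> t0 tk; have [mb [N [mN N0 HN]]] := regular_time t0 tk.
have [M [L [M0 L0 _ b lip]]] := common_support.
pose g (n : nat) z := n.+1%:R * (integrand (t + n.+1%:R^-1) z - integrand t z).
have mg n : measurable_fun setT (g n).
  apply: measurable_funM => //.
  by apply: measurable_funB; exact: measurable_integrand.
have mbx := @measurable_box R (- M) M (- M) M.
have [] := @dominated_convergence _ _ _ mu setT measurableT (fun n z => (g n z)%:E)
  (fun z => (f z * field_derivative t (flow t z))%:E)
  (fun z => (L * \1_(box (- M) M (- M) M) z)%:E).
- by move=> n; apply/measurable_EFinP; exact: mg.
- apply/measurable_EFinP; apply: measurable_funM => //.
  exact: (measurableT_comp (measurable_field_derivative_flow mb) (measurable_flow t)).
- exists N; split=> // z /=; apply: contra_notP => Nz _.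
  have [e e0 He] := HN z Nz.
  apply/fine_cvgP; split; first exact: nearW.
  rewrite field_derivativeE.
  have c := @test_increment_cvg _ _ phi_test (t, flow t z) (1, depauw_b (t, flow t z)).
  have {c} : (f z * (n.+1%:R * (phi ((t, flow t z) + n.+1%:R^-1 *: (1, depauw_b (t, flow t z))) -
      phi (t, flow t z)))) @[n --> \oo] --> f z * 'D_(1, depauw_b (t, flow t z)) phi (t, flow t z).
    by apply: cvgMr.
  apply: cvg_trans; apply: near_eq_cvg.
  have := @cvg_harmonic R; move/cvgrPdist_le => /(_ e e0); apply: filterS => n.
  rewrite sub0r normrN => /He fl; rewrite /= /g /integrand -mulrBr mulrCA fl.
  by congr (_ * (_ * (phi _ - _))); congr pair; rewrite /= /GRing.scale /= mulr1.
- by apply: integrable_scaled_indic => //; exact: box_fin.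
- apply: aeW => z n _; rewrite lee_fin /g normrM ger0_norm//.
  rewrite mulrC -ler_pdivlMr//; apply: le_trans (lip _ _ _) _.
  by rewrite addrAC subrr add0r ger0_norm ?invr_ge0// mulrAC.
move=> I _ lim; split=> //; apply: cvg_trans lim.
apply: near_eq_cvg; apply: nearW => n /=.
have Ig : mu.-integrable setT (EFin \o (fun z => integrand (t + n.+1%:R^-1) z - integrand t z)).
  apply: (integrable_supported mbx (box_fin_lt M) _ (lip t (t + n.+1%:R^-1))).
  by apply: measurable_funB; exact: measurable_integrand.
rewrite /increment mean_difference /g.
under eq_integral do rewrite EFinM.
by rewrite integralZl// EFinM /Rintegral fineK//; exact: integrable_fin_num.
Qed.

Lemma flow_change_of_variables (t : R) (h : mR * mR -> \bar R) : 0 < t ->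
  measurable_fun setT h -> mu.-integrable setT (h \o flow t) ->
  (\int[mu]_x h x = \int[mu]_z h (flow t z))%E.
Proof.
move=> t0 mh ih; have [mfl fl1] := mp_flow t0.
have := @integral_pushforward _ _ _ _ _ _ mfl mu setT h mh.
rewrite preimage_setT => /(_ ih measurableT) <-.
by apply: eq_measure_integral => A mA _; rewrite -fl1.
Qed.

Lemma transport_integral (t : R) : 0 < t -> (forall k, t != 2 ^- k) ->
  (\int[mu]_x (transport f (t, x) * field_derivative t x)%:E =
   \int[mu]_z (f z * field_derivative t (flow t z))%:E)%E.
Proof.
move=> t0 tk; have [mb _] := regular_time t0 tk.
have [I _] := increment_mean_cvg t0 tk.
have E z : transport f (t, flow t z) = f z by exact: transport_flow.
rewrite (@flow_change_of_variables t) //.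
- by apply: eq_integral => z _; rewrite E.
- apply/measurable_EFinP; apply: measurable_funM; last exact: measurable_field_derivative_flow.
  apply: (measurableT_comp (measurable_transport mf)).
  apply/measurable_fun_pairP; split; first exact: measurable_cst.
  exact: measurable_id.
- by rewrite (_ : _ \o _ = fun z => (f z * field_derivative t (flow t z))%:E)//;
    apply/funext => z /=; rewrite E.
Qed.

Lemma transport_weak :
  (\int[leb]_(t in `[0%R, +oo[) \int[mu]_x
      (transport f (t, x) * (dt phi (t, x) + dot2 (depauw_b (t, x)) (grad_x phi (t, x))))%:E
   = (- \int[mu]_z (f z * phi (0, flow 0 z)))%:E)%E.
Proof.
have [M [L [M0 L0 late b lip]]] := common_support.
have mbx := @measurable_box R (- M) M (- M) M.
(* The added 1 makes the Lipschitz constant positive, as required when integrating the right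
   derivative. *)
pose K := L * fine (mu (box (- M) M (- M) M)) + 1.
have KL0 : 0 <= L * fine (mu (box (- M) M (- M) M)).
  by rewrite mulr_ge0//; [exact: ltW|exact/fine_ge0/measure_ge0].
have K0 : 0 < K by rewrite ltr_wpDl.
have FL s t : `|mean t - mean s| <= K * `|t - s|.
  rewrite mean_difference.
  have mI : measurable_fun setT (fun z => integrand t z - integrand s z).
    by apply: measurable_funB; exact: measurable_integrand.
  apply: le_trans (le_norm_Rintegral_supported mbx (box_fin_lt M) mI (lip s t)) _.
  by rewrite mulrAC ler_wpM2r// lerDl.
have FM t : M <= t -> mean t = 0.
  move=> Mt; rewrite /mean /Rintegral integral0_eq// => z _.
  by rewrite late.
rewrite -[X in (- X)%:E]/(mean 0).
apply: (@integral_right_derivative R mean K M K0 M0 FL FM _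
    (* The exceptional times are 0, encoded by [None], and the powers 2^-j. *)
    (range (fun k => if k is Some j then 2 ^- j else 0 : R))).
  exact: sub_countable (card_image_le _ _) (countableP _).
move=> t t0 tC.
have {}t0 : 0 < t.
  rewrite lt_neqAle t0 andbT; apply/eqP => t0'; apply: tC.
  by exists None => //; rewrite -t0'.
have {tC}tk k : t != 2 ^- k by apply/eqP => tk; apply: tC; exists (Some k).
have := transport_integral t0 tk; rewrite /field_derivative => ->.
exact: (increment_mean_cvg t0 tk).2.
Qed.

End WeakFormulation.

(** * Initial data *)

(** Turns an integral over one colour into an integral over the plane for a restricted measure,
    which can then be pushed forward. *)
Lemma integral_restriction d (T : measurableType d) (R : realType)
    (mu r : {measure set T -> \bar R}) (D : set T) (f : T -> \bar R) :
  measurable D -> (forall A, r A = mu (A `&` D)) -> r.-integrable setT f ->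
  (\int[r]_x f x = \int[mu]_(x in D) f x)%E.
Proof.
move=> mD rE rf; have r0 : r (~` D) = 0%E by rewrite rE setICl measure0.
have mDC : measurable (~` D) by exact: measurableC.
rewrite (negligible_integral mDC measurableT rf r0) setTD setCK.
by apply: eq_measure_integral => A mA AD; rewrite rE (setIidl AD).
Qed.

Section Datum.
Context {R : realType}.
Local Notation mR := (measurableTypeR R).
Local Notation mu := (@leb2 R).

(** Both terms are integrals of [k] against the image of one colour under [flow 0], and twice this
    image is [leb2] by [colour_measure]. The bounded support of [k] ensures integrability. *)
Lemma integral_colour_flow0 s (k : mR * mR -> R) (c M : R) :
  measurable_fun setT (k : mR * mR -> mR) ->
  (forall x, `|k x| <= c * \1_(box (- M) M (- M) M) x) ->
  (\int[mu]_(z in colour s) (k (flow 0 z))%:E + \int[mu]_(z in colour s) (k (flow 0 z))%:E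
   = \int[mu]_x (k x)%:E)%E.
Proof.
move=> mk kc; set b := box _ _ _ _ in kc.
have mY : measurable_fun setT (flow 0 : mR * mR -> mR * mR) by exact: measurable_flow.
have mb : measurable b by exact: measurable_box.
have mYb : measurable (flow 0 @^-1` b) by exact: preimage_measurable.
have mkY : measurable_fun setT (k \o flow 0) by exact: (measurableT_comp mk mY).
have mkE : measurable_fun setT (EFin \o k) by exact/measurable_EFinP.
have mC := @measurable_colour R s.
have [m [mE mI mint]] : exists m : {measure set (mR * mR) -> \bar R},
  [/\ forall A, m A = mu (colour s `&` flow 0 @^-1` A), m.-integrable setT (EFin \o k) &
   (\int[m]_x (k x)%:E = \int[mu]_(z in colour s) (k (flow 0 z))%:E)%E].
  have [r rE] : exists r : {measure set (mR * mR) -> \bar R},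
      forall A, r A = mu (A `&` colour s).
    by exists [the {measure set (mR * mR) -> \bar R} of mrestr mu mC].
  have rI : r.-integrable setT (EFin \o (k \o flow 0)).
    have := @integrable_supported _ _ R r (flow 0 @^-1` b) (k \o flow 0) c mYb _ mkY.
    apply.
      rewrite rE; apply: le_lt_trans (flow0_box_fin (- M) M (- M) M).
      by apply: (le_measure mu); rewrite ?inE; [exact: measurableI| |exact: subIsetl].
    by move=> z; exact: kc.
  have {}rI : r.-integrable setT ((EFin \o k) \o flow 0) := rI.
  exists (measure_function_pushforward__canonical__measure_function_Measure r mY); split.
  - by move=> A; rewrite /= /pushforward rE setIC.
  - by apply: integrable_pushforward.
  - rewrite -(integral_restriction mC rE rI).
    have := integral_pushforward mY (D := setT) mkE rI measurableT.
    by rewrite preimage_setT.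
have addE : (\int[measure_add m m]_x (k x)%:E = \int[mu]_x (k x)%:E)%E.
  apply: eq_measure_integral => A mA _.
  by apply: etrans (measure_addE m m A) _; rewrite mE colour_measure.
by rewrite -addE (integral_measure_add measurableT mI mI) mint.
Qed.

End Datum.

(** * Solutions built from two functions, one on each colour *)

Section ColouredSolutions.
Context {R : realType}.
Local Notation mR := (measurableTypeR R).
Local Notation mu := (@leb2 R).
Implicit Types (g h : mR * mR -> mR).

Definition coloured g h (z : mR * mR) : mR :=
  if chess 1 z then g (flow 0 z) else h (flow 0 z).

Lemma measurable_coloured g h : measurable_fun setT g -> measurable_fun setT h ->
  measurable_fun setT (coloured g h).
Proof.
move=> mg mh; have mY := @measurable_flow R 0.
apply: measurable_fun_ifT; first exact: measurable_chess.
- exact: (measurableT_comp mg mY).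
- exact: (measurableT_comp mh mY).
Qed.

Lemma coloured_bound g h (B : R) : (forall x, `|g x : R| <= B) -> (forall x, `|h x : R| <= B) ->
  forall x, `|coloured g h x : R| <= B.
Proof. by move=> gB hB x; rewrite /coloured; case: ifP. Qed.

Lemma test_slice_support (phi : R * (R * R) -> R) : test_function phi ->
  exists C M : R, [/\ 0 < C, 0 < M &
    forall x, `|phi (0, x)| <= C * \1_(box (- M) M (- M) M) (x : mR * mR)].
Proof.
move=> tphi; have [C C0 HC] := test_bound tphi; have [M M0 HM] := test_support tphi.
exists C, M; split=> // x; rewrite indicE; have [_|] := boolP (x \in _); first by rewrite mulr1.
rewrite notin_setE => nx; rewrite HM ?normr0 ?mulr0//.
rewrite norm_time_space normr0 lt_max; apply/orP; right.
by rewrite ltNge; apply/negP; rewrite norm_pair_le !ler_norml => /andP[? ?]; apply: nx.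
Qed.

Lemma coloured_datum g h (B : R) (phi : R * (R * R) -> R) : 0 < B ->
  measurable_fun setT g -> measurable_fun setT h ->
  (forall x, `|g x : R| <= B) -> (forall x, `|h x : R| <= B) -> test_function phi ->
  ((\int[mu]_z (coloured g h z * phi (0, flow 0 z)))%:E =
   \int[mu]_x ((g x + h x) / 2 * phi (0, x))%:E)%E.
Proof.
move=> B0 mg mh gB hB tphi; have [C [M [C0 M0 CM]]] := test_slice_support tphi.
have mphi : measurable_fun setT (fun x : mR * mR => phi (0, x) : mR).
  apply: measurable_continuous_plane; apply: continuous_slice.
  exact: test_continuous tphi.
have mb := @measurable_box R (- M) M (- M) M.
have fb := @box_fin R (- M) M (- M) M.
have mY := @measurable_flow R 0.
have mYb : measurable (flow 0 @^-1` box (- M) M (- M) M) by exact: preimage_measurable.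
have fYb := @flow0_box_fin R (- M) M (- M) M.
have bd (k : mR * mR -> mR) x : (forall y, `|k y : R| <= B) ->
    `|k x * phi (0, x)| <= (B * C) * \1_(box (- M) M (- M) M) x.
  by move=> kB; rewrite normrM -mulrA; apply: ler_pM.
have mk (k : mR * mR -> mR) : measurable_fun setT k ->
    measurable_fun setT (fun x => k x * phi (0, x) : mR).
  by move=> m; exact: measurable_funM.
have Ik k : measurable_fun setT k -> (forall y, `|k y : R| <= B) ->
    mu.-integrable setT (EFin \o (fun x => k x * phi (0, x))).
  by move=> m kB; apply: (integrable_supported mb fb (mk k m)) => x; exact: bd.
have IY k s : measurable_fun setT k -> (forall y, `|k y : R| <= B) ->
    mu.-integrable (colour s) (fun z => (k (flow 0 z) * phi (0, flow 0 z))%:E).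
  move=> m kB; apply: (integrableS measurableT) => //; first exact: measurable_colour.
  have mkY : measurable_fun setT ((fun x => k x * phi (0, x)) \o flow 0).
    exact: (measurableT_comp (mk k m) mY).
  have := @integrable_supported _ _ R mu _ ((fun x => k x * phi (0, x)) \o flow 0) (B * C)
    mYb fYb mkY.
  by apply => z; exact: (bd k (flow 0 z) kB).
have Eg := integral_colour_flow0 true (mk g mg) (fun x => bd g x gB).
have Eh := integral_colour_flow0 false (mk h mh) (fun x => bd h x hB).
have fin k s : measurable_fun setT k -> (forall y, `|k y : R| <= B) ->
    (\int[mu]_(z in colour s) (k (flow 0 z) * phi (0, flow 0 z))%:E)%E \is a fin_num.
  by move=> m kB; apply: integrable_fin_num; [exact: measurable_colour|exact: IY].
have mf : measurable_fun setT (fun z => (coloured g h z * phi (0, flow 0 z))%:E).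
  apply/measurable_EFinP; apply: measurable_funM; first exact: measurable_coloured.
  exact: (measurableT_comp mphi mY).
have split_colours : (\int[mu]_z (coloured g h z * phi (0, flow 0 z))%:E =
    \int[mu]_(z in colour true) (g (flow 0 z) * phi (0, flow 0 z))%:E +
    \int[mu]_(z in colour false) (h (flow 0 z) * phi (0, flow 0 z))%:E)%E.
  have U : colour true `|` colour false = [set: mR * mR].
    by apply/seteqP; split=> // z _; rewrite /colour /=; case: (chess 1 z); [left|right].
  rewrite -U integral_setU ?U//; do ?exact: measurable_colour.
    congr (_ + _)%E; apply: eq_integral => z; rewrite inE /colour /= /coloured.
      by move=> /eqP ->.
    by move=> /eqP ->.
  apply/disj_setPS => z; rewrite /colour /= => -[/eqP -> /eqP].
  by [].
have half : (\int[mu]_x ((g x + h x) / 2 * phi (0, x))%:E =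
    2^-1%:E * (\int[mu]_x (g x * phi (0, x))%:E + \int[mu]_x (h x * phi (0, x))%:E))%E.
  rewrite -integralD//; [|exact: Ik|exact: Ik].
  rewrite -integralZl//; last by apply: integrableD => //; exact: Ik.
  apply: eq_integral => x _; rewrite -EFinD -EFinM; congr EFin.
  by rewrite -mulrDl mulrA [2^-1 * _]mulrC.
rewrite half -Eg -Eh /Rintegral split_colours.
rewrite -(fineK (fin g true mg gB)) -(fineK (fin h false mh hB)).
rewrite -!EFinD -EFinM /=; congr EFin; lra.
Qed.

Lemma coloured_weak_solution g h (B : R) (rhobar : R * R -> R) :
  measurable_fun setT g -> measurable_fun setT h ->
  (forall x, `|g x : R| <= B) -> (forall x, `|h x : R| <= B) ->
  measurable_fun setT (rhobar : mR * mR -> mR) ->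
  {ae mu, forall x, (g x + h x) / 2 = rhobar x} ->
  bounded_weak_solution (@depauw_b R) rhobar (transport (coloured g h)).
Proof.
move=> mg mh gB hB mr ae.
(* [B] may be 0, while the weak formulation asks for a positive bound. *)
have B0 : 0 < B + 1 by rewrite ltr_wpDl// (le_trans (normr_ge0 _) (gB 0)).
have gB1 x : `|g x : R| <= B + 1 by apply: le_trans (gB x) _; rewrite lerDl.
have hB1 x : `|h x : R| <= B + 1 by apply: le_trans (hB x) _; rewrite lerDl.
have mf := measurable_coloured mg mh; have fB := coloured_bound gB1 hB1.
split; first exact: transport_Linfty_loc mf fB.
move=> phi tphi; rewrite (transport_weak mf B0 fB tphi) EFinN.
rewrite (coloured_datum B0 mg mh gB1 hB1 tphi); congr (- _)%E.
have mphi : measurable_fun setT (fun x : mR * mR => phi (0, x) : mR).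
  apply: measurable_continuous_plane; apply: continuous_slice.
  exact: test_continuous tphi.
apply: ae_eq_integral => //.
- apply/measurable_EFinP; apply: measurable_funM => //; apply: measurable_funM => //.
  exact: measurable_funD.
- by apply/measurable_EFinP; exact: measurable_funM.
- by apply: filterS ae => x /= E _; rewrite E.
Qed.

Lemma leb2_setT_gt0 : (0 < mu setT)%E.
Proof.
have : (0 < mu (box 0 1 0 1))%E.
  have pos : (0 < lebesgue_measure (`[0%R, 1%R]%classic : set R))%E.
    by rewrite lebesgue_measure_itv /= lte_fin ltr01 -EFinB subr0 lte_fin ltr01.
  by rewrite boxE /leb2 product_measure1E//; apply: mule_gt0; exact: pos.
move/lt_le_trans; apply; apply: (le_measure mu); rewrite ?inE //.
exact: measurable_box.
Qed.

(** From time 1 on the transported functions equal [f1] and [f2], so they differ on the product of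
    [1, 2] with the set where [f1] and [f2] differ. *)
Lemma distinct_transport (f1 f2 : mR * mR -> mR) :
  measurable_fun setT f1 -> measurable_fun setT f2 ->
  (0 < mu [set x | f1 x != f2 x :> R])%E ->
  distinct_solutions (transport f1) (transport f2).
Proof.
move=> m1 m2 pos; rewrite /distinct_solutions.
pose E : set (mR * mR) := [set x | f1 x != f2 x :> R].
have mneq disp (T : measurableType disp) (u v : T -> mR) :
    measurable_fun setT u -> measurable_fun setT v -> measurable [set x | u x != v x :> R].
  move=> mu' mv; apply: measurable_bool; apply: measurable_neg.
  exact: measurable_fun_eqr.
have mE : measurable E by exact: mneq.
have mI : measurable (`[1, 2]%classic : set mR) by exact: measurable_itv.
pose D : set (mR * (mR * mR)) := [set z | (0 < z.1) /\ transport f1 z <> transport f2 z].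
have mD : measurable D.
  rewrite (_ : D = [set z | (0 : R) < z.1] `&` [set z | transport f1 z != transport f2 z :> R]).
    apply: measurableI; last by apply: mneq; exact: measurable_transport.
    apply: measurable_bool; apply: measurable_fun_ltr => //; exact: measurable_fst.
  by apply/seteqP; split=> z [z0 /eqP ne].
apply: (@lt_le_trans _ _ (@leb3 R (`[1, 2] `*` E))).
  have posI : (0 < lebesgue_measure (`[1%R, 2%R]%classic : set R))%E.
    by rewrite lebesgue_measure_itv /= lte_fin ltr1n -EFinB lte_fin subr_gt0 ltr1n.
  by rewrite /leb3 product_measure1E//; apply: mule_gt0; [exact: posI|exact: pos].
apply: (le_measure (@leb3 R)); rewrite ?inE//; first exact: measurableX.
move=> [t x] [/=]; rewrite in_itv /= => /andP[t1 _] /eqP ne; split.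
  exact: lt_le_trans t1.
by rewrite !transport_ge1.
Qed.

Lemma transport_nonnegative (f : mR * mR -> mR) : (forall x, 0 <= (f x : R)) ->
  nonnegative_solution (transport f).
Proof. by move=> f0; apply: aeW => p _; have [->|[z ->]] := transport_value f p. Qed.

(** The datum is bounded, or nonnegative, only almost everywhere, whereas transport uses bounds at
    every point; clamping changes the datum on a null set only. *)
Definition clamp (a b : R) (u : R) : R := Num.max a (Num.min b u).

Lemma clamp_id a b u : a <= u <= b -> clamp a b u = u.
Proof. by move=> /andP[au ub]; rewrite /clamp (min_idPr ub) (max_idPr au). Qed.

Lemma clamp_bounds a b u : a <= b -> a <= clamp a b u <= b.
Proof. by move=> ab; rewrite /clamp le_max lexx ge_max ab ge_min lexx. Qed.

Lemma measurable_clamp a b (r : mR * mR -> mR) : measurable_fun setT r ->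
  measurable_fun setT (fun x => clamp a b (r x) : mR).
Proof. by move=> mr; apply: measurable_maxr => //; exact: measurable_minr. Qed.

Lemma Linfty_ae_bound (r : mR * mR -> mR) : r \in Lfun mu +oo%E ->
  measurable_fun setT r /\ exists2 M : R, 0 < M & {ae mu, forall x, `|r x : R| <= M}.
Proof.
move=> rL; split; first by have := sub_Lfun_mfun rL; rewrite inE.
have := sub_Lfun_finLfun rL; rewrite inE /= /finite_norm unlock leb2_setT_gt0.
move=> /ess_supr_bounded[M HM]; exists (`|M| + 1); first by rewrite ltr_wpDl.
apply: filterS HM => x /= xM; apply: le_trans xM _; apply: le_trans (ler_norm _) _.
by rewrite lerDl.
Qed.

End ColouredSolutions.

Theorem theorem1p11 (R : realType) (rhobar : R * R -> R)
    (rhobar_Linfty : rhobar \in Lfun (@leb2 R) +oo%E) :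
  (exists rho1 rho2 : R * (R * R) -> R,
     [/\ bounded_weak_solution (@depauw_b R) rhobar rho1,
         bounded_weak_solution (@depauw_b R) rhobar rho2 &
         distinct_solutions rho1 rho2]) /\
  ({ae @leb2 R, forall x, 0 <= rhobar x} ->
   ~ {ae @leb2 R, forall x, rhobar x = 0} ->
   exists rho1 rho2 : R * (R * R) -> R,
     [/\ bounded_weak_solution (@depauw_b R) rhobar rho1,
         bounded_weak_solution (@depauw_b R) rhobar rho2,
         distinct_solutions rho1 rho2,
         nonnegative_solution rho1 &
         nonnegative_solution rho2]).
Proof.
have aeF : Filter (nbhs (almost_everywhere (@leb2 R))).
  exact: ae_filter_ringOfSetsType.
have [mr [M M0 rM]] := Linfty_ae_bound rhobar_Linfty.
split.
  pose g x := clamp (- M) M (rhobar x).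
  have mg : measurable_fun setT g by exact: measurable_clamp.
  have gM x : `|g x| <= M by rewrite ler_norml; apply: clamp_bounds; lra.
  have gE : {ae @leb2 R, forall x, g x = rhobar x}.
    by apply: filterS rM => x; rewrite ler_norml => /clamp_id.
  pose h (c : R) x := g x + c.
  have mh c : measurable_fun setT (h c) by exact: measurable_funD.
  have hM c x : `|c| <= 1 -> `|h c x| <= M + 1.
    by move=> c1; apply: le_trans (ler_normD _ _) _; exact: lerD.
  have sol c : `|c| <= 1 -> bounded_weak_solution (@depauw_b R) rhobar
      (transport (coloured (h c) (h (- c)))).
    move=> c1; apply: (coloured_weak_solution (B := M + 1)) => //.
    - exact: mh.
    - exact: mh.
    - by move=> x; exact: hM.
    - by move=> x; apply: hM; rewrite normrN.
    - move: gE; apply: filterS => x <-; rewrite /h; lra.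
  exists (transport (coloured (h 0) (h (- 0)))), (transport (coloured (h 1) (h (- 1)))); split.
  - by apply: sol; rewrite normr0.
  - by apply: sol; rewrite normr1.
  - apply: distinct_transport; do ?[by apply: measurable_coloured; exact: mh].
    (* Passing from c = 0 to c = 1 changes the function by 1 on one colour and by - 1 on the other,
       hence everywhere. *)
    rewrite (_ : [set _ | _] = setT); first exact: leb2_setT_gt0.
    apply/seteqP; split=> // z _ /=; rewrite /coloured /h.
    by case: ifP => _; apply/eqP; lra.
move=> r0 rn0; pose g x := clamp 0 M (rhobar x).
have mg : measurable_fun setT g by exact: measurable_clamp.
have gM x : 0 <= g x <= M by apply: clamp_bounds; exact: ltW.
have gE : {ae @leb2 R, forall x, g x = rhobar x}.
  apply: filterS2 rM r0 => x; rewrite ler_norml => /andP[_ xM] x0.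
  by apply: clamp_id; rewrite x0.
have sol (c c' : R) : 0 <= c <= 2 -> 0 <= c' <= 2 -> c + c' = 2 ->
    bounded_weak_solution (@depauw_b R) rhobar
      (transport (coloured (fun x => c * g x) (fun x => c' * g x))).
  move=> c2 c2' cc'.
  have cM k x : 0 <= k <= 2 -> `|k * g x| <= 2 * M.
    move=> /andP[k0 k2]; have /andP[g0 gx] := gM x.
    by rewrite normrM (ger0_norm k0) (ger0_norm g0) ler_pM.
  apply: (coloured_weak_solution (B := 2 * M)) => //.
  - exact: measurable_funM.
  - exact: measurable_funM.
  - by move=> x; exact: cM.
  - by move=> x; exact: cM.
  - by move: gE; apply: filterS => x <-; rewrite -mulrDl cc'; lra.
exists (transport (coloured (fun x => 1 * g x) (fun x => 1 * g x))),
  (transport (coloured (fun x => 2 * g x) (fun x => 0 * g x))); split.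
- by apply: sol; rewrite ?ler01 ?ler1n.
- by apply: sol; rewrite ?lexx ?ler0n ?addr0.
- apply: distinct_transport; do ?[by apply: measurable_coloured; exact: measurable_funM].
  pose Z : set (measurableTypeR R * measurableTypeR R) := [set x | g x != 0].
  have mZ : measurable Z.
    by apply: measurable_bool; apply: measurable_neg; exact: measurable_fun_eqr.
  (* On either colour the factors 1 and 1 become 2 and 0, so the functions differ exactly where [g]
     composed with [flow 0] is nonzero. As [flow 0] preserves measure, this set is null only if the
     datum vanishes almost everywhere. *)
  rewrite (_ : [set _ | _] = flow 0 @^-1` Z).
    rewrite flow0_measure// lt_neqAle measure_ge0 andbT eq_sym; apply/eqP => Z0.
    apply: rn0; have nZ : {ae @leb2 R, forall x, g x = 0}.
      exists Z; split => // x; rewrite /Z /= => nx; exact/eqP.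
    by apply: filterS2 gE nZ => x <-.
  apply/seteqP; split=> z; rewrite /Z /= /coloured.
    by case: ifP => _; apply: contra_neq => ->; rewrite !mulr0.
  by move=> gz; case: ifP => _; apply: contra_neq gz; lra.
- apply: transport_nonnegative => x; rewrite /coloured.
  by case: ifP => _; rewrite mul1r; have /andP[] := gM (flow 0 x).
- apply: transport_nonnegative => x; rewrite /coloured.
  by case: ifP => _; apply: mulr_ge0 => //; have /andP[] := gM (flow 0 x).
Qed.
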